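(* Let $n\in\mathbb{N}=\{0,1,2,\ldots\}$ and $a\in(-n-1,-n)$. For all $\xi\in\mathbb{R}$, $$\int_{-\infty}^\infty e^{-i\xi s}\,|\Gamma(a+is)|^2\,ds=\frac{2\pi}{2^{2a}}\int_0^\infty x^{2a-1}\left(1+\left(\frac{2}{x}\right)^{2a}\sum_{k=0}^n\frac{4(a+k)}{k!\,\Gamma(1-k-2a)}K_{2a+2k}(x)\right)e^{-x\cosh(\xi/2)}\,dx .$$
   Context: $\Gamma$ is the Euler Gamma function, with $1/\Gamma$ understood as an entire function (so $1/\Gamma(-m)=0$ for $m=0,1,2,\ldots$). For $w\in\mathbb{C}$ and $y>0$, $K_w(y)=\int_0^\infty e^{-y\cosh x}\cosh(wx)\,dx$ is the modified Bessel function of the second kind (Macdonald function). *)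

(* Defs.v *)
From HB Require Import structures.
From mathcomp Require Import all_boot all_order all_algebra.
From mathcomp Require Import complex.
From mathcomp Require Import all_classical all_reals all_analysis.

Set Implicit Arguments.
Unset Strict Implicit.
Unset Printing Implicit Defensive.

Import Order.TTheory GRing.Theory Num.Theory.
Import numFieldNormedType.Exports.

Local Open Scope classical_set_scope.
Local Open Scope complex_scope.
Local Open Scope ring_scope.

(* The library integrates real and extended real functions only, hence these
   componentwise definitions for complex-valued functions. *)
Definition cintegrable (R : realType) (D : set R) (f : R -> R[i]) : Prop :=
  (@lebesgue_measure R).-integrable D (fun x => (complex.Re (f x))%:E) /\
  (@lebesgue_measure R).-integrable D (fun x => (complex.Im (f x))%:E).

Definition cintegral (R : realType) (D : set R) (f : R -> R[i]) : R[i] :=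
  Rintegral (@lebesgue_measure R) D (fun x => complex.Re (f x)) +i*
  Rintegral (@lebesgue_measure R) D (fun x => complex.Im (f x)).

Definition cexp (R : realType) (z : R[i]) : R[i] :=
  (expR (complex.Re z))%:C * (cos (complex.Im z) +i* sin (complex.Im z)).

Definition ccosh (R : realType) (z : R[i]) : R[i] :=
  (cexp z + cexp (- z)) / 2.

Definition cosh (R : realType) (x : R) : R := (expR x + expR (- x)) / 2.

(* x ^ z, meant for x > 0 only. *)
Definition cpow (R : realType) (x : R) (z : R[i]) : R[i] :=
  cexp (z * (ln x)%:C).

(* Euler's integral, meant for Re z > 0 only. *)
Definition Gamma_int (R : realType) (z : R[i]) : R[i] :=
  cintegral `]0, +oo[ (fun t => cpow t (z - 1) * (expR (- t))%:C).

(* The number of applications of Gamma(z) = Gamma(z + 1) / z that bring z to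
   the half-plane Re z > 0. *)
Definition Gamma_shift (R : realType) (z : R[i]) : nat :=
  if 0 < complex.Re z then 0%N else (Num.truncn (- complex.Re z)).+1.

(* The meromorphic continuation of Euler's integral by the functional equation.
   At z = 0, -1, -2, ... the denominator has a zero factor, so Gamma z = 0 by
   the convention 0^-1 = 0; hence (Gamma z)^-1 is everywhere the value of the
   entire function 1 / Gamma, including 0 at the poles of Gamma. *)
Definition Gamma (R : realType) (z : R[i]) : R[i] :=
  Gamma_int (z + (Gamma_shift z)%:R) / \prod_(k < Gamma_shift z) (z + k%:R).

(* Meant for y > 0 only. *)
Definition BesselK (R : realType) (w : R[i]) (y : R) : R[i] :=
  cintegral `]0, +oo[ (fun x => (expR (- y * cosh x))%:C * ccosh (w * x%:C)).

(* Main.v *)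
(* Write nu = - 2 a and x = e^y, and let
     D_nu(y) = x^{2a} (1 + (2/x)^{2a} sum_{k<=n} 4(a+k) K_{2a+2k}(x) / (k! Gamma(1-k-2a))).
   The functions e^{-nu y} and K_w(e^y) solve u'' = (nu^2 + e^{2y}) u - e^{(2-nu)y}
   and u'' = (w^2 + e^{2y}) u, and the coefficients are such that
   D_nu'' = (nu^2 + e^{2y}) D_nu - D_{nu-2}, where D_{nu-2} is built in the same way
   from a + 1 and n - 1. The first term of the sum cancels the leading behaviour
   of x^{2a} at 0, and variation of constants against K_nu then shows, by
   induction on n, that D_nu(y) decays exponentially as y -> -oo.
   Let T_s(y) be the integral of exp(-e^y cosh u) cos(2su) over the real line, a solution
   of u'' = (e^{2y} - 4 s^2) u. Integrating the derivative of the Wronskian of D_nu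
   and T_s gives 4 (a^2 + s^2) int D_nu T_s = int D_{nu-2} T_s, the recurrence that
   |Gamma(a + is)|^2 satisfies, whence |Gamma(a + is)|^2 = 2^{1-2a} int D_nu T_s (for
   0 < a < 1 and an empty sum, this is the autocorrelation of e^{av} exp(-e^v)).
   So |Gamma(a + is)|^2 is, up to a constant, the cosine transform of
   xi |-> int D_nu(y) exp(-e^y cosh(xi/2)) dy, and being nonnegative it can be
   inverted by Abel summation. *)
Require Import Defs.
From HB Require Import structures.
From mathcomp Require Import all_boot all_order all_algebra.
From mathcomp Require Import complex.
From mathcomp Require Import all_classical all_reals all_analysis.
From mathcomp Require Import measurable_realfun.
From mathcomp Require Import ring lra.

Set Implicit Arguments.
Unset Strict Implicit.
Unset Printing Implicit Defensive.

Import Order.TTheory GRing.Theory Num.Theory.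
Import numFieldNormedType.Exports.

Local Open Scope classical_set_scope.
Local Open Scope complex_scope.
Local Open Scope ring_scope.

(** * Continuity and integration on the real line *)

(** The delicate point is the cancellation at 0. For [nu = - 2 a > 2 n] the power [x^{2a}] and all
    the Macdonald functions in the sum are singular there, and seeing every singular term disappear
    would take a comparison of their series. Instead, only the leading term is compared, with an
    error smaller by some positive power of [x]. This weak bound already excludes a multiple of
    [K_nu] from [D_nu]; the other homogeneous solution decays like [x^nu], so the source [D_{nu-2}]
    dictates the decay. At infinity growth like [x^2] is allowed, because [T_s] and
    [exp (- x cosh (xi / 2))] decay faster than any power of [x]. No estimate of Gamma on vertical
    lines enters. The integrability of [|Gamma(a + is)|^2] comes out of its sign: its integrals
    damped by [exp (- e |s|)] increase as [e] decreases to 0, and Poisson's kernel shows that they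
    have a finite limit. The open interval for [a] keeps [nu] strictly between [2 n] and [2 n + 2],
    a condition stable under lowering [nu] by 2 and [n] by 1. *)

Section Continuity.
Context {R : realType} {T : topologicalType}.
Implicit Types f g : T -> R.

Lemma ctsD f g : continuous f -> continuous g -> continuous (fun x => f x + g x).
Proof. by move=> cf cg x; apply: cvgD; [exact: cf|exact: cg]. Qed.

Lemma ctsN f : continuous f -> continuous (fun x => - f x).
Proof. by move=> cf x; apply: cvgN; exact: cf. Qed.

Lemma ctsM f g : continuous f -> continuous g -> continuous (fun x => f x * g x).
Proof. by move=> cf cg x; apply: cvgM; [exact: cf|exact: cg]. Qed.

Lemma cts_cst (c : R) : continuous (fun _ : T => c).
Proof. by move=> x; exact: cvg_cst. Qed.

Lemma ctsX f n : continuous f -> continuous (fun x => f x ^+ n).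
Proof.
move=> cf; elim: n => [|n IH]; first exact: cts_cst.
rewrite (_ : (fun x => _) = (fun x => f x * f x ^+ n)); first exact: ctsM.
by apply/funext => x; rewrite exprS.
Qed.

Lemma ctsV f : (forall x, f x != 0) -> continuous f ->
  continuous (fun x => (f x)^-1).
Proof. by move=> f0 cf x; apply: cvgV => //; exact: cf. Qed.

Lemma cts_comp (h : R -> R) f : continuous h -> continuous f ->
  continuous (fun x => h (f x)).
Proof. by move=> ch cf x; apply: (continuous_comp (cf x)); exact: ch. Qed.

Lemma cts_norm f : continuous f -> continuous (fun x => `|f x|).
Proof. by move=> cf x; apply: cvg_norm; exact: cf. Qed.

Lemma cts_expR f : continuous f -> continuous (fun x => expR (f x)).
Proof. by apply: cts_comp; exact: continuous_expR. Qed.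

Lemma cts_cos f : continuous f -> continuous (fun x => cos (f x)).
Proof. by apply: cts_comp; exact: continuous_cos. Qed.

Lemma cts_sin f : continuous f -> continuous (fun x => sin (f x)).
Proof. by apply: cts_comp; exact: continuous_sin. Qed.

Lemma cts_cosh f : continuous f -> continuous (fun x => cosh (f x)).
Proof.
move=> cf; apply: ctsM; last exact: cts_cst.
by apply: ctsD; apply: cts_expR => //; exact: ctsN.
Qed.

End Continuity.

Lemma cts_id (R : realType) : continuous (fun x : R => x).
Proof. by move=> x; exact: cvg_id. Qed.

Ltac cts := first [ assumption |
  lazymatch goal with |- forall _, continuous_at _ ?F =>
  lazymatch F with
  | (fun _ => ?c) => exact (@cts_cst _ _ c)
  | (fun x => x) => exact (@cts_id _)
  | (fun x => GRing.add (@?f x) (@?g x)) => refine (@ctsD _ _ f g _ _); cts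
  | (fun x => GRing.opp (@?f x)) => refine (@ctsN _ _ f _); cts
  | (fun x => GRing.mul (@?f x) (@?g x)) => refine (@ctsM _ _ f g _ _); cts
  | (fun x => GRing.exp (@?f x) ?n) => refine (@ctsX _ _ f n _); cts
  | (fun x => expR (@?f x)) => refine (@cts_expR _ _ f _); cts
  | (fun x => cos (@?f x)) => refine (@cts_cos _ _ f _); cts
  | (fun x => sin (@?f x)) => refine (@cts_sin _ _ f _); cts
  | (fun x => cosh (@?f x)) => refine (@cts_cosh _ _ f _); cts
  | (fun x => Num.Def.normr (@?f x)) => refine (@cts_norm _ _ f _); cts
  | (fun x => ?h (@?f x)) => refine (@cts_comp _ _ h f _ _); cts
  | GRing.opp => refine (@ctsN _ _ (fun x => x) _); cts
  | expR => exact: continuous_expR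
  | cos => exact: continuous_cos
  | sin => exact: continuous_sin
  end end ].

Section Integrals.
Context {R : realType}.
Notation mu := (@lebesgue_measure R).
Implicit Types f g h : R -> R.

Definition intg f := mu.-integrable setT (EFin \o f).

Lemma intg_dom f g : measurable_fun setT f -> (forall x, `|f x| <= g x) ->
  intg g -> intg f.
Proof.
move=> mf fg; apply: le_integrable => //; first exact/measurable_EFinP.
by move=> x _ /=; rewrite lee_fin (le_trans (fg x))// ler_norm.
Qed.

Lemma intg_le f g : continuous f -> (forall x, `|f x| <= g x) -> intg g -> intg f.
Proof. by move=> cf; apply: intg_dom; exact: continuous_measurable_fun. Qed.

Lemma intg_meas f : intg f -> measurable_fun setT f.
Proof. by move=> /measurable_int/measurable_EFinP. Qed.

Lemma intgD f g : intg f -> intg g -> intg (fun x => f x + g x).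
Proof.
move=> i1 i2; rewrite /intg; have := @integrableD _ _ _ mu _ measurableT _ _ i1 i2.
by apply: eq_integrable => // x _ /=; rewrite EFinD.
Qed.

Lemma intgZ c f : intg f -> intg (fun x => c * f x).
Proof.
move=> i1; rewrite /intg; have := @integrableZl _ _ _ mu _ measurableT c _ i1.
by apply: eq_integrable => // x _ /=; rewrite EFinM.
Qed.

Lemma intgN f : intg f -> intg (fun x => - f x).
Proof.
by move=> /(intgZ (-1)); apply: eq_integrable => // x _ /=; rewrite mulN1r.
Qed.

Lemma intgB f g : intg f -> intg g -> intg (fun x => f x - g x).
Proof. by move=> i1 i2; apply: intgD => //; exact: intgN. Qed.

Lemma intg_norm f : intg f -> intg (fun x => `|f x|).
Proof. by move=> /integrable_norm. Qed.

Lemma intg_eq f g : f =1 g -> intg f -> intg g.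
Proof. by move=> /funext ->. Qed.

Lemma RintD f g : intg f -> intg g ->
  \int[mu]_x (f x + g x) = \int[mu]_x f x + \int[mu]_x g x.
Proof. by move=> i1 i2; rewrite RintegralD. Qed.

Lemma RintB f g : intg f -> intg g ->
  \int[mu]_x (f x - g x) = \int[mu]_x f x - \int[mu]_x g x.
Proof. by move=> i1 i2; rewrite RintegralB. Qed.

Lemma RintZ c f : intg f -> \int[mu]_x (c * f x) = c * \int[mu]_x f x.
Proof. by move=> i1; rewrite RintegralZl. Qed.

Lemma Rint_le f g : intg f -> intg g -> (forall x, f x <= g x) ->
  \int[mu]_x f x <= \int[mu]_x g x.
Proof. by move=> i1 i2 fg; apply: le_Rintegral. Qed.

Lemma Rint_norm_le f g : measurable_fun setT f -> intg g ->
  (forall x, `|f x| <= g x) -> `|\int[mu]_x f x| <= \int[mu]_x g x.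
Proof.
move=> mf ig fg; have jf := intg_dom mf fg ig.
apply: le_trans (le_normr_Rintegral _ jf) _ => //.
by apply: Rint_le => //; exact: intg_norm.
Qed.

Lemma Rint_EFin f : intg f -> (\int[mu]_x (f x)%:E)%E = (\int[mu]_x f x)%:E.
Proof. by move=> jf; rewrite /Rintegral fineK//; exact: integrable_fin_num. Qed.

Lemma Rint_gt0 f : continuous f -> intg f -> (forall x, 0 < f x) ->
  0 < \int[mu]_x f x.
Proof.
move=> cf jf f0.
have f00 x : 0 <= f x by exact: ltW.
have ic : intg (fun x => (f x) * (\1_`[(0:R), 1] x)).
  apply: (@intg_dom _ f) => //.
    apply: measurable_funM; first exact: continuous_measurable_fun.
    exact: measurable_indic.
  move=> x; rewrite indicE; case: (_ \in _) => /=;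
  by rewrite ?mulr1 ?mulr0 ?normr0 ?ger0_norm.
(* The unit interval alone gives strict positivity: there [f] is at least its minimum [f c], which
   is positive. *)
have [c /[!in_itv]/= c01 cm] := @EVT_min R f 0 1 ler01 (continuous_subspaceT cf).
apply: (@lt_le_trans _ _ (\int[mu]_x (f c * \1_`[(0:R), 1] x))).
  rewrite RintZ; last exact: integrable_indic_itv.
  rewrite mulr_gt0// /Rintegral integral_indic//= setIT.
  by rewrite lebesgue_measure_itv/= lte_fin ltr01 -EFinB/= subr0.
apply: (@le_trans _ _ (\int[mu]_x (f x * \1_`[(0:R), 1] x))).
  apply: Rint_le => //; first by apply: intgZ; exact: integrable_indic_itv.
  move=> x; rewrite indicE; case: (boolP (x \in _)) => [|_]; last by rewrite !mulr0.
  by rewrite inE/= => x01; rewrite !mulr1 cm.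
apply: Rint_le => // x; rewrite indicE; case: (_ \in _);
  by rewrite ?mulr1 ?mulr0.
Qed.

(** A majorant that splits as [g x * h y] makes [F] integrable on the product by Tonelli. Every
    interchange of integrals below is justified by a majorant of this shape. *)
Lemma Rfubini (F : R * R -> R) g h : measurable_fun setT F ->
  intg g -> intg h -> (forall x y, `|F (x, y)| <= g x * h y) ->
  \int[mu]_x (\int[mu]_y F (x, y)) = \int[mu]_y (\int[mu]_x F (x, y)).
Proof.
move=> mF ig ih Fgh.
have mF1 x : measurable_fun setT (fun y => F (x, y)).
  by apply: (measurableT_comp mF); exact: pair1_measurable.
have mF2 y : measurable_fun setT (fun x => F (x, y)).
  by apply: (measurableT_comp mF); exact: pair2_measurable.
have i1 x : intg (fun y => F (x, y)).
  by apply: intg_dom (Fgh x) _ => //; exact: intgZ.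
have i2 y : intg (fun x => F (x, y)).
  apply: (@intg_dom _ (fun x => h y * g x)) => //; last exact: intgZ.
  by move=> x; rewrite mulrC.
have iF : (mu \x mu)%E.-integrable setT (EFin \o F).
  apply/integrable12ltyP; first exact/measurable_EFinP.
  apply: (@le_lt_trans _ _ (\int[mu]_x ((\int[mu]_y h y) * g x)%:E)%E); last first.
    by rewrite Rint_EFin ?ltry//; exact: intgZ.
  apply: ge0_le_integral => //=.
  - by move=> x _; apply: integral_ge0.
  - apply: (@measurable_fun_fubini_tonelli_F _ _ _ _ _ mu (fun z => (`|F z|)%:E)) => //.
    by apply/measurable_EFinP; apply: measurableT_comp.
  - by apply/measurable_EFinP; apply: intg_meas; exact: intgZ.
  - move=> x _; rewrite Rint_EFin; last exact: intg_norm (i1 x).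
    rewrite lee_fin mulrC -RintZ//; apply: Rint_le => //; last exact: intgZ.
    exact: intg_norm (i1 x).
have := Fubini iF; rewrite /Rintegral => E.
congr fine; transitivity (\int[mu]_x \int[mu]_y (EFin \o F) (x, y))%E.
  by apply: eq_integral => x _ /=; rewrite [RHS](Rint_EFin (i1 x)).
by rewrite E; apply: eq_integral => x _ /=; rewrite [LHS](Rint_EFin (i2 x)).
Qed.

Lemma Rdominated (f_ : nat -> R -> R) f g : (forall n, measurable_fun setT (f_ n)) ->
  measurable_fun setT f -> intg g -> (forall n x, `|f_ n x| <= g x) ->
  (forall x, f_ n x @[n --> \oo] --> f x) ->
  intg f /\ \int[mu]_x f_ n x @[n --> \oo] --> \int[mu]_x f x.
Proof.
move=> mf_ mf ig fg ff.
have [] := @dominated_convergence _ _ _ mu setT measurableT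
  (fun n => EFin \o f_ n) (EFin \o f) (EFin \o g).
- by move=> n; apply/measurable_EFinP; exact: mf_.
- by apply/measurable_EFinP; exact: mf.
- by apply/aeW => x _; apply: cvg_EFin; [exact: nearW | exact: ff].
- exact: ig.
- by apply/aeW => x n _ /=; rewrite lee_fin.
move=> jf _ cc; split => //.
rewrite /Rintegral; apply: fine_cvg.
rewrite fineK; last exact: integrable_fin_num.
exact: cc.
Qed.

End Integrals.

(** * Rules of differentiation *)

Section Derivatives.
Context {R : realType}.
Implicit Types (f g : R -> R) (x a b : R).

Lemma dvD f g x a b : is_derive x 1 f a -> is_derive x 1 g b ->
  is_derive x 1 (fun t => f t + g t) (a + b).
Proof. by move=> df dg; exact: (is_deriveD df dg). Qed.

Lemma dvN f x a : is_derive x 1 f a -> is_derive x 1 (fun t => - f t) (- a).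
Proof. by move=> df; exact: (is_deriveN df). Qed.

Lemma dvM f g x a b : is_derive x 1 f a -> is_derive x 1 g b ->
  is_derive x 1 (fun t => f t * g t) (a * g x + f x * b).
Proof.
move=> df dg; apply: is_derive_eq (is_deriveM df dg) _.
by rewrite addrC ![_ *: _]mulrC [b * _]mulrC.
Qed.

Lemma dv_cst c x : is_derive x 1 (fun _ => c) (0 : R).
Proof. exact: is_derive_cst. Qed.

Lemma dv_id x : is_derive x 1 (fun t : R => t) (1 : R).
Proof. exact: is_derive_id. Qed.

Lemma dv_comp f g x a b : is_derive (g x) 1 f a -> is_derive x 1 g b ->
  is_derive x 1 (fun t => f (g t)) (a * b).
Proof. by move=> df dg; exact: is_derive1_comp. Qed.

Lemma dv_expR f x a : is_derive x 1 f a ->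
  is_derive x 1 (fun t => expR (f t)) (expR (f x) * a).
Proof. exact: dv_comp. Qed.

Lemma dv_cos f x a : is_derive x 1 f a ->
  is_derive x 1 (fun t => cos (f t)) (- sin (f x) * a).
Proof. exact: dv_comp. Qed.

Lemma dv_sin f x a : is_derive x 1 f a ->
  is_derive x 1 (fun t => sin (f t)) (cos (f x) * a).
Proof. exact: dv_comp. Qed.

Lemma dvV f x a : f x != 0 -> is_derive x 1 f a ->
  is_derive x 1 (fun t => (f t)^-1) (- (f x)^-2 * a).
Proof. by move=> f0 df; exact: (is_deriveV f0). Qed.

Definition sinh (x : R) := (expR x - expR (- x)) / 2.

Lemma dv_eq f x a b : is_derive x 1 f a -> a = b -> is_derive x 1 f b.
Proof. by move=> ? <-. Qed.

Lemma dv_cosh f x a : is_derive x 1 f a ->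
  is_derive x 1 (fun t => cosh (f t)) (sinh (f x) * a).
Proof.
move=> df; apply: (dv_eq (dvM (dvD (dv_expR df) (dv_expR (dvN df)))
  (dv_cst 2^-1 x))).
by rewrite /sinh; field.
Qed.

Lemma dv_sinh f x a : is_derive x 1 f a ->
  is_derive x 1 (fun t => sinh (f t)) (cosh (f x) * a).
Proof.
move=> df; apply: (dv_eq (dvM (dvD (dv_expR df) (dvN (dv_expR (dvN df))))
  (dv_cst 2^-1 x))).
by rewrite /cosh; field.
Qed.

Lemma dv_cts f df : (forall x : R, is_derive x 1 f (df x)) -> continuous f.
Proof. by move=> d x; apply/differentiable_continuous/derivable1_diffP. Qed.

End Derivatives.

Ltac der1 := first [ eassumption
  | match goal with H : forall _, is_derive _ _ _ _ |- _ => exact (H _) end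
  | lazymatch goal with |- is_derive _ _ ?F _ =>
  lazymatch F with
  | (fun _ => ?c) => exact (dv_cst c _)
  | (fun x => x) => exact (dv_id _)
  | (fun x => GRing.add (@?f x) (@?g x)) => notypeclasses refine (@dvD _ f g _ _ _ _ _)
  | (fun x => GRing.opp (@?f x)) => notypeclasses refine (@dvN _ f _ _ _)
  | (fun x => GRing.mul (@?f x) (@?g x)) => notypeclasses refine (@dvM _ f g _ _ _ _ _)
  | (fun x => expR (@?f x)) => notypeclasses refine (@dv_expR _ f _ _ _)
  | (fun x => cos (@?f x)) => notypeclasses refine (@dv_cos _ f _ _ _)
  | (fun x => sin (@?f x)) => notypeclasses refine (@dv_sin _ f _ _ _)
  | (fun x => cosh (@?f x)) => notypeclasses refine (@dv_cosh _ f _ _ _)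
  | (fun x => sinh (@?f x)) => notypeclasses refine (@dv_sinh _ f _ _ _)
  | @cosh _ => notypeclasses refine (@dv_cosh _ (fun x => x) _ _ _)
  | @sinh _ => notypeclasses refine (@dv_sinh _ (fun x => x) _ _ _)
  | @expR _ => notypeclasses refine (@dv_expR _ (fun x => x) _ _ _)
  end end ].
(** The rules build the derivative from the syntax of the function, as an existential variable; one
    equation with the claimed value remains, for [ring] or [field]. *)
Ltac der := notypeclasses refine (dv_eq _ _); [repeat der1|cbv beta delta [Datatypes.id]].

(** * Changes of variable, improper integrals and exponential majorants *)

Section Substitution.
Context {R : realType}.
Notation mu := (@lebesgue_measure R).
Implicit Types f g h : R -> R.

(** Substitution theorems for nonnegative integrands extend to signed ones through the halves of
    [|f| + f] and [|f| - f]. The last clause hands symmetries of [f] on to [p] and [q]. *)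
Lemma posneg f : continuous f -> intg f -> exists p q : R -> R,
  [/\ continuous p, continuous q, intg p & intg q] /\
  [/\ forall x, 0 <= p x, forall x, 0 <= q x, f = (fun x => p x - q x)
    & forall x y, f x = f y -> p x = p y /\ q x = q y].
Proof.
move=> cf jf; have jn := intg_norm jf.
exists (fun x => 2^-1 * (`|f x| + f x)), (fun x => 2^-1 * (`|f x| - f x)).
split; split.
- by cts.
- by cts.
- by apply: intgZ; exact: intgD.
- by apply: intgZ; exact: intgB.
- by move=> x; have := ler_norm (- f x); rewrite normrN; lra.
- by move=> x; have := ler_norm (f x); lra.
- by apply/funext => x; lra.
- by move=> x y ->.
Qed.

Lemma Rint_affine (c e : R) f : 0 < c -> continuous f -> intg f ->
  intg (fun x => f (c * x + e)) /\
  \int[mu]_x f (c * x + e) = c^-1 * \int[mu]_x f x.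
Proof.
move=> c0 cf jf; have c00 : c != 0 by rewrite gt_eqF.
have ca : continuous (fun x : R => c * x + e) by cts.
have key g : continuous g -> intg g -> (forall x, 0 <= g x) ->
    intg (fun x => g (c * x + e)) /\
    \int[mu]_x g (c * x + e) = c^-1 * \int[mu]_x g x.
  move=> cg jg g0.
  have dF (x : R) : is_derive x 1 (fun x => c * x + e) c.
    der.
    ring.
  have dFE : derive1 (fun x : R => c * x + e) = cst c.
    by apply/funext => x; rewrite derive1E; apply: derive_val.
  have E : (\int[mu]_x (g x)%:E = \int[mu]_x (g (c * x + e) * c)%:E)%E.
    rewrite (@increasing_ge0_integration_by_substitutionT _ (fun x => c * x + e)) //.
    - by apply: eq_integral => x _; rewrite dFE.
    - by move=> x y xy; rewrite ltrD2r ltr_pM2l.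
    - by rewrite dFE => x; exact: cvg_cst.
    - by rewrite dFE; exact: is_cvg_cst.
    - by rewrite dFE; exact: is_cvg_cst.
    - by apply/cvgrNyPle => A; near=> x; rewrite -lerBrDr mulrC -ler_pdivlMr//;
        near: x; exact: nbhs_ninfty_le.
    - by apply/cvgryPge => A; near=> x; rewrite -lerBlDr mulrC -ler_pdivrMr//;
        near: x; exact: nbhs_pinfty_ge.
  have jc : intg (fun x => g (c * x + e) * c).
    apply/integrableP; split.
      apply/measurable_EFinP; apply: continuous_measurable_fun.
      by apply: ctsM; [exact: cts_comp|exact: cts_cst].
    rewrite (_ : (\int[mu]_x `|_|)%E = \int[mu]_x (g x)%:E)%E.
      by rewrite Rint_EFin// ltry.
    rewrite E; apply: eq_integral => x _ /=.
    by rewrite ger0_norm// mulr_ge0// ltW.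
  have jg' : intg (fun x => g (c * x + e)).
    by apply: intg_eq (intgZ c^-1 jc) => x /=; rewrite mulrC mulfK.
  split => //; rewrite {2}/Rintegral E -/(Rintegral _ _ _) RintegralZr//.
  by rewrite mulrC mulfK.
have [p [q [[cp cq jp jq] [p0 q0 fE pq]]]] := posneg cf jf.
have [jp' Ip] := key p cp jp p0; have [jq' Iq] := key q cq jq q0.
rewrite fE; split; first exact: intgB.
by rewrite !RintB// Ip Iq mulrBr.
Unshelve. all: by end_near. Qed.

Lemma Rint_shift e f : continuous f -> intg f ->
  intg (fun x => f (x + e)) /\ \int[mu]_x f (x + e) = \int[mu]_x f x.
Proof.
move=> cf jf; have [j I] := @Rint_affine 1 e f ltr01 cf jf.
have E : (fun x => f (x + e)) = (fun x => f (1 * x + e)).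
  by apply/funext => x; rewrite mul1r.
by rewrite E; split => //; rewrite I invr1 mul1r.
Qed.

Lemma Rint_opp f : continuous f -> intg f ->
  intg (fun x => f (- x)) /\ \int[mu]_x f (- x) = \int[mu]_x f x.
Proof.
move=> cf jf.
have key g : continuous g -> (forall x, 0 <= g x) ->
  (\int[mu]_x (g (- x))%:E = \int[mu]_x (g x)%:E)%E.
  (* Cutting at 0 gives two integrals over the half-line, which a reflection merely exchanges. *)
  have Spl h : continuous h -> (forall x, 0 <= h x) ->
    (\int[mu]_x (h x)%:E = \int[mu]_(x in `[0%R, +oo[) (h x)%:E +
       \int[mu]_(x in `[0%R, +oo[) (h (- x))%:E)%E.
    move=> ch h0.
    have mh : measurable_fun setT h by exact: continuous_measurable_fun.
    rewrite -[X in (\int[mu]_(x in X) _)%E](setUv `[0%R, +oo[%classic).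
    rewrite ge0_integral_setU//= ; last 4 first.
    - exact: measurableC.
    - by apply/measurable_EFinP; rewrite setUv.
    - by move=> x _; rewrite lee_fin.
    - exact/disj_setPCl.
    congr (_ + _)%E; rewrite setCitvr.
    rewrite integral_itv_bndo_bndc; last exact/measurable_EFinP/measurable_funTS.
    rewrite -{1}oppr0 ge0_integration_by_substitutionNy//.
    exact: continuous_subspaceT.
  move=> cg g0; rewrite [RHS]Spl// Spl//; last by apply: cts_comp => //; cts.
  by rewrite addeC; congr (_ + _)%E; apply: eq_integral => x _; rewrite opprK.
have jo g : continuous g -> intg g -> intg (fun x => g (- x)).
  move=> cg jg; apply/integrableP; split.
    apply/measurable_EFinP; apply: continuous_measurable_fun.
    by apply: cts_comp => //; cts.
  rewrite /= (key (fun x => `|g x|))//; last by cts.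
  by case/integrableP: jg.
split; first exact: jo.
have [p [q [[cp cq jp jq] [p0 q0 fE pq]]]] := posneg cf jf.
have jp' := jo p cp jp; have jq' := jo q cq jq.
rewrite fE !RintB//; congr (_ - _); congr fine; exact: key.
Qed.

Lemma Rint_even f : continuous f -> intg f -> (forall x, f (- x) = f x) ->
  mu.-integrable `]0%R, +oo[ (EFin \o f) /\
  \int[mu]_(x in `]0%R, +oo[) f x = 2^-1 * \int[mu]_x f x.
Proof.
move=> cf jf ef.
have iS : mu.-integrable `]0%R, +oo[ (EFin \o f) by apply: integrableS jf.
split => //.
have key g : continuous g -> intg g -> (forall x, 0 <= g x) ->
    (forall x, g (- x) = g x) ->
    \int[mu]_x g x = 2 * \int[mu]_(x in `]0%R, +oo[) g x.
  move=> cg jg g0 eg.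
  have jS : mu.-integrable `]0%R, +oo[ (EFin \o g) by apply: integrableS jg.
  rewrite {1}/Rintegral ge0_symfun_integralT//; last by move=> x /=; rewrite eg.
  rewrite -set_itvcy -integral_itv_obnd_cbnd; last by case/integrableP: jS.
  by rewrite fineM//; exact: integrable_fin_num.
have [p [q [[cp cq jp jq] [p0 q0 fE pq]]]] := posneg cf jf.
have ep x : p (- x) = p x by case: (pq _ _ (ef x)).
have evq x : q (- x) = q x by case: (pq _ _ (ef x)).
rewrite fE RintB// (key p)// (key q)// RintegralB//.
- by rewrite -mulrBr mulrA mulVf// mul1r.
- exact: integrableS jp.
- exact: integrableS jq.
Qed.

(** The substitution [y = ln x] is singular at 0. It is made on the half-lines [A n] from
    [expR (- n)], which correspond to the half-lines [B n] from [- n]; monotone convergence passes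
    to the unions on both sides. *)
Lemma ge0_integral_ln h : continuous h -> (forall x, 0 <= h x) ->
  (\int[mu]_(x in `]0%R, +oo[) (h (ln x) / x)%:E = \int[mu]_x (h x)%:E)%E.
Proof.
move=> ch h0.
have cV (x : R) : 0 < x -> y^-1 @[y --> x] --> x^-1.
  by move=> x0; apply: cvgV; [rewrite gt_eqF|exact: cvg_id].
pose A (n : nat) := `[expR (- n%:R : R), +oo[%classic.
pose B (n : nat) := `[(- n%:R : R), +oo[%classic.
have chl (x : R) : 0 < x -> {for x, continuous (fun x => h (ln x) / x)}.
  move=> x0; apply: cvgM; last by apply: cvgV; [rewrite gt_eqF|exact: cvg_id].
  by apply: (continuous_comp (continuous_ln x0)); exact: ch.
have m0 : measurable_fun (`]0%R, +oo[%classic : set R) (fun x => h (ln x) / x).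
  apply: open_continuous_measurable_fun => // x; rewrite inE/= in_itv/= andbT.
  exact: chl.
have subA n : A n `<=` `]0%R, +oo[.
  move=> x; rewrite /A/= !in_itv/= !andbT; apply: lt_le_trans; exact: expR_gt0.
have E n : (\int[mu]_(x in A n) (h (ln x) / x)%:E = \int[mu]_(x in B n) (h x)%:E)%E.
  have a0 : 0 < expR (- n%:R : R) by exact: expR_gt0.
  have dl (x : R) : 0 < x -> derive1 (@ln R) x = x^-1.
    by move=> x0; rewrite derive1E; apply: derive_val; exact: is_derive1_ln.
  rewrite /B -{1}(expRK (- n%:R)).
  rewrite (@increasing_ge0_integration_by_substitutiony _ (@ln R))//.
  - apply: eq_integral => x; rewrite inE /A /= in_itv/= andbT => xa.
    by congr EFin; rewrite -[RHS]/(h (ln x) * derive1 (@ln R) x) dl// (lt_le_trans a0).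
  - move=> x y; rewrite !in_itv/= !andbT => xa ya.
    by rewrite ltr_ln// posrE (lt_le_trans a0).
  - move=> x; rewrite in_itv/= andbT => xa; have x0 := lt_trans a0 xa.
    rewrite /continuous_at dl//.
    apply: cvg_trans (cV _ x0).
    apply: near_eq_cvg; near=> y; rewrite dl//; near: y.
    exact: lt_nbhsr.
  - apply/cvg_ex; exists (expR (- n%:R))^-1.
    apply: (@cvg_trans _ (y^-1 @[y --> (expR (- n%:R : R))^'+])).
      by apply: near_eq_cvg; near=> y; rewrite dl// (lt_trans a0).
    by apply: cvg_at_right_filter; exact: cV.
  - apply/cvg_ex; exists 0.
    apply: (@cvg_trans _ (y^-1 @[y --> +oo%R])).
      by apply: near_eq_cvg; near=> y; rewrite dl//.
    apply/cvgrPdist_le => k k0; near=> y.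
    have ky : k^-1 <= y by near: y; apply: nbhs_pinfty_ge; rewrite num_real.
    have y0 : 0 < y by apply: lt_le_trans ky; rewrite invr_gt0.
    rewrite sub0r normrN ger0_norm; last by rewrite invr_ge0 ltW.
    by rewrite -[leRHS]invrK lef_pV2// posrE ?invr_gt0.
  - split.
      move=> x; rewrite in_itv/= andbT => xa; have x0 := lt_trans a0 xa.
      by have := is_derive1_ln x0.
    by apply: cvg_at_right_filter; exact: continuous_ln.
  - apply/cvgryPge => M; near=> x.
    have Mx : expR M <= x by near: x; apply: nbhs_pinfty_ge; rewrite num_real.
    by rewrite -(expRK M) ler_ln ?posrE ?expR_gt0// (lt_le_trans (expR_gt0 M)).
  - exact: continuous_subspaceT.
have bA : \bigcup_n A n = `]0%R, +oo[%classic.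
  apply/seteqP; split => [x [n _ /subA//]|x /=]; rewrite in_itv/= andbT => x0.
  exists (Num.bound `|ln x|) => //; rewrite /A/= in_itv/= andbT.
  rewrite -[leRHS](@lnK _ x) ?posrE// ler_expR.
  by rewrite lerNl (le_trans (ler_norm _))// normrN ltW// archi_boundP.
have bB : \bigcup_n B n = setT.
  apply/seteqP; split => // x _.
  exists (Num.bound `|x|) => //; rewrite /B/= in_itv/= andbT.
  by rewrite lerNl (le_trans (ler_norm _))// normrN ltW// archi_boundP.
have cA : (\int[mu]_(x in A n) (h (ln x) / x)%:E)%E @[n --> \oo] -->
    (\int[mu]_(x in \bigcup_n A n) (h (ln x) / x)%:E)%E.
  apply: ge0_nondecreasing_set_cvg_integral => //.
  - move=> m n mn; rewrite subsetEset => x; rewrite /A/= !in_itv/= !andbT.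
    by apply: le_trans; rewrite ler_expR lerN2 ler_nat.
  - by move=> n; exact: measurable_itv.
  - move=> n; have mE : measurable_fun (`]0%R, +oo[%classic : set R)
        (fun x : R => (h (ln x) / x)%:E) by apply/measurable_EFinP.
    have mS : measurable (`]0%R, +oo[%classic : set R) by [].
    exact: (measurable_funS mS (subA n) mE).
  - move=> n x /subA; rewrite /= in_itv/= andbT => x0.
    by rewrite lee_fin divr_ge0// ltW.
have cB : (\int[mu]_(x in B n) (h x)%:E)%E @[n --> \oo] -->
    (\int[mu]_(x in \bigcup_n B n) (h x)%:E)%E.
  apply: ge0_nondecreasing_set_cvg_integral => //.
  - move=> m n mn; rewrite subsetEset => x; rewrite /B/= !in_itv/= !andbT.
    by apply: le_trans; rewrite lerN2 ler_nat.
  - by move=> n; exact: measurable_itv.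
  - move=> n; apply: measurable_funTS; apply/measurable_EFinP.
    exact: continuous_measurable_fun.
  - by move=> n x _; rewrite lee_fin.
rewrite -bA -bB; apply: (cvg_unique _ cA) => //.
by rewrite (funext E).
Unshelve. all: by end_near. Qed.

Lemma Rint_ln h : continuous h -> intg h ->
  mu.-integrable `]0%R, +oo[ (fun x => (h (ln x) / x)%:E) /\
  \int[mu]_(x in `]0%R, +oo[) (h (ln x) / x) = \int[mu]_x h x.
Proof.
move=> ch jh.
have key g : continuous g -> intg g -> (forall x, 0 <= g x) ->
   mu.-integrable `]0%R, +oo[ (fun x => (g (ln x) / x)%:E).
  move=> cg jg g0; apply/integrableP; split.
    apply/measurable_EFinP; apply: open_continuous_measurable_fun => // x.
    rewrite inE/= in_itv/= andbT => x0.
    apply: cvgM; last by apply: cvgV; [rewrite gt_eqF|exact: cvg_id].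
    by apply: (continuous_comp (continuous_ln x0)); exact: cg.
  rewrite (_ : (\int[mu]_(x in _) _)%E = \int[mu]_x (g x)%:E)%E; last first.
    rewrite -ge0_integral_ln//; apply: eq_integral => x.
    rewrite inE/= in_itv/= andbT => x0; rewrite ger0_norm//.
    by rewrite divr_ge0// ltW.
  by rewrite Rint_EFin// ltry.
have [p [q [[cp cq jp jq] [p0 q0 fE pq]]]] := posneg ch jh.
split.
  rewrite (_ : (fun x : R => (h (ln x) / x)%:E) =
    (fun x => (p (ln x) / x)%:E - (q (ln x) / x)%:E)%E); last first.
    by apply/funext => x; rewrite fE mulrBl EFinB.
  by apply: integrableB => //; exact: key.
transitivity (\int[mu]_(x in `]0%R, +oo[) (p (ln x) / x - q (ln x) / x)).
  by apply: eq_Rintegral => x _; rewrite fE mulrBl.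
rewrite RintegralB//; [|exact: key|exact: key].
by rewrite fE RintB// /Rintegral !ge0_integral_ln.
Qed.

(** On the growing intervals this is the usual fundamental theorem, and [|f|] restricted to [S]
    dominates the truncations. The set [S] is a parameter so as to serve the whole line as well as
    the open half-line, where the lower endpoint tends to 0. *)
Lemma FTC_seq (F f : R -> R) (S : set R) (a b : nat -> R) (l m : R) :
  measurable S -> (forall x : R, is_derive x 1 F (f x)) -> continuous f ->
  mu.-integrable S (EFin \o f) -> (forall n, a n < b n) ->
  (forall n, `[a n, b n] `<=` S) ->
  (forall x, S x -> \forall n \near \oo, `[a n, b n]%classic x) ->
  F (b n) @[n --> \oo] --> l -> F (a n) @[n --> \oo] --> m ->
  \int[mu]_(x in S) f x = l - m.
Proof.
move=> mS dF cf jf ab abS Sab Fl Fm.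
have jS : intg (f \_ S).
  by rewrite /intg -restrict_EFin; apply/integrable_restrict => //=; rewrite setTI.
have mf : measurable_fun setT f by exact: continuous_measurable_fun.
have E n : \int[mu]_x (f \_ `[a n, b n]) x = F (b n) - F (a n).
  rewrite -Rintegral_mkcond /Rintegral (@continuous_FTC2 _ f F)//.
  - exact: continuous_subspaceT.
  - split=> [x _||].
    + by have := dF x.
    + by apply: cvg_at_right_filter; exact: (dv_cts dF).
    + by apply: cvg_at_left_filter; exact: (dv_cts dF).
  - by move=> x _; rewrite derive1E; apply: derive_val.
have mr (A : set R) : measurable A -> measurable_fun setT (f \_ A).
  by move=> mA; apply/(measurable_restrictT f mA); exact: measurable_funTS.
have [|||||_ C] := @Rdominated _ (fun n => f \_ `[a n, b n]) (f \_ S) (fun x => `|(f \_ S) x|).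
- by move=> n; exact: mr.
- exact: mr.
- exact: (intg_norm jS).
- move=> n x; rewrite /patch; case: ifPn => [|_]; last by rewrite normr0.
  by rewrite inE => /abS /mem_set ->.
- move=> x; apply: cvg_near_cst; rewrite /patch; case: ifPn => [|].
    rewrite inE => /Sab; apply: filterS => n /= H.
    by rewrite mem_set.
  rewrite notin_setE => nS; apply: nearW => n.
  by rewrite memNset// => /abS.
rewrite Rintegral_mkcond; apply: (cvg_unique _ C) => //.
by rewrite (funext E); exact: cvgB.
Qed.

Lemma Rint_FTC (F f : R -> R) (l m : R) :
  (forall x : R, is_derive x 1 F (f x)) -> continuous f -> intg f ->
  F x @[x --> +oo] --> l -> F x @[x --> -oo] --> m ->
  \int[mu]_x f x = l - m.
Proof.
move=> dF cf jf Fl Fm.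
apply: (@FTC_seq F f setT (fun n => - n.+1%:R) (fun n => n.+1%:R)) => //.
- by move=> n; apply: (@lt_trans _ _ 0); rewrite ?oppr_lt0 ltr0n.
- move=> x _; near=> n; rewrite /= in_itv/= -ler_norml.
  rewrite (@le_trans _ _ n%:R)// ?ler_nat//; near: n; exact: nbhs_infty_ger.
- apply: (cvg_comp _ _ _ Fl); apply/cvgryPge => A; near=> n.
  rewrite (@le_trans _ _ n%:R)// ?ler_nat//; near: n; exact: nbhs_infty_ger.
- apply: (cvg_comp _ _ _ Fm); apply/cvgrNyPle => A; near=> n.
  rewrite lerNl (@le_trans _ _ n%:R)// ?ler_nat//; near: n; exact: nbhs_infty_ger.
Unshelve. all: by end_near. Qed.

Lemma cauchy_gt0 (x : R) : 0 < 1 + x ^+ 2.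
Proof. by rewrite ltr_pwDl// sqr_ge0. Qed.

Lemma cts_cauchy : continuous (fun x : R => (1 + x ^+ 2)^-1).
Proof. by apply: ctsV; [move=> x; rewrite gt_eqF// cauchy_gt0|cts]. Qed.

Lemma cauchy_int : intg (fun x : R => (1 + x ^+ 2)^-1) /\
  \int[mu]_x ((1 + x ^+ 2)^-1) = pi :> R.
Proof.
have E : (\int[mu]_x ((1 + x ^+ 2)^-1)%:E = (pi : R)%:E)%E.
  have c0 (x : R) : 0 <= (1 + x ^+ 2)^-1 by rewrite invr_ge0 ltW// cauchy_gt0.
  rewrite ge0_symfun_integralT//; last 2 first.
  - exact: cts_cauchy.
  - by move=> x /=; rewrite sqrrN.
  rewrite -set_itvcy (@ge0_continuous_FTC2y _ _ (@atan R) _ (pi / 2))//.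
  - by rewrite atan0 sube0 -EFinM mulrC divfK.
  - by apply: continuous_subspaceT; exact: cts_cauchy.
  - exact: cvgy_atan.
  - by apply: cvg_at_right_filter; exact: continuous_atan.
  - by move=> x _; rewrite derive1_atan.
split; last by rewrite /Rintegral E.
apply/integrableP; split.
  apply/measurable_EFinP; apply: continuous_measurable_fun; exact: cts_cauchy.
rewrite (_ : (\int[mu]_x _)%E = (pi : R)%:E) ?ltry// -E.
by apply: eq_integral => x _ /=; rewrite ger0_norm// invr_ge0 ltW// cauchy_gt0.
Qed.

Lemma intg_cauchy_le f (C : R) : continuous f ->
  (forall x, `|f x| * (1 + x ^+ 2) <= C) -> intg f.
Proof.
move=> cf fC; apply: (@intg_le _ _ (fun x => C * (1 + x ^+ 2)^-1)) => //.
  by move=> x; rewrite ler_pdivlMr// cauchy_gt0.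
by apply: intgZ; case: cauchy_int.
Qed.

Lemma sqr_le_expR (x : R) : 0 <= x -> 1 + x ^+ 2 / 4 <= expR x.
Proof.
move=> x0; have -> : expR x = expR (x / 2) ^+ 2.
  by rewrite -expRM_natr; congr expR; field.
have : (1 + x / 2) ^+ 2 <= expR (x / 2) ^+ 2.
  by rewrite ler_sqr ?nnegrE ?expR_ge0 ?expR_ge1Dx//; lra.
by apply: le_trans; nra.
Qed.

(** With [t = k |x|], the bound [1 + t^2 / 4 <= expR t] reduces exponential decay to decay like
    [1 / (1 + x^2)], whose integral is known from the arctangent. *)
Lemma expR_abs_cauchy (k x : R) : 0 < k ->
  expR (- (k * `|x|)) * (1 + x ^+ 2) <= 1 + 4 / k ^+ 2.
Proof.
move=> k0; rewrite expRN mulrC ler_pdivrMr ?expR_gt0//.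
have := sqr_le_expR (mulr_ge0 (ltW k0) (normr_ge0 x)).
rewrite exprMn real_normK ?num_real// => H.
have K : 0 < 1 + 4 / k ^+ 2 by rewrite ltr_pwDl// divr_ge0// sqr_ge0.
apply: le_trans (ler_wpM2l (ltW K) H).
have -> : (1 + 4 / k ^+ 2) * (1 + k ^+ 2 * x ^+ 2 / 4) =
  1 + x ^+ 2 + (4 / k ^+ 2 + k ^+ 2 * x ^+ 2 / 4) by field; lra.
by rewrite lerDl; apply: addr_ge0; apply: divr_ge0 => //; rewrite -?exprMn sqr_ge0.
Qed.

Lemma intg_expabs (k : R) : 0 < k -> intg (fun x => expR (- (k * `|x|))).
Proof.
move=> k0; apply: (@intg_cauchy_le _ (1 + 4 / k ^+ 2)); first by cts.
by move=> x; rewrite ger0_norm ?expR_ge0// expR_abs_cauchy.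
Qed.

Lemma intg_expabs_le f (C k : R) : 0 < k -> continuous f ->
  (forall x, `|f x| <= C * expR (- (k * `|x|))) -> intg f.
Proof.
by move=> k0 cf fC; apply: intg_le fC _ => //; apply: intgZ; exact: intg_expabs.
Qed.

End Substitution.

(** * Integrals of Macdonald type *)

Section Hyperbolic.
Context {R : realType}.
Implicit Types x y u w k : R.

Lemma cosh_gt0 u : 0 < cosh u :> R.
Proof. by rewrite /cosh divr_gt0// addr_gt0// expR_gt0. Qed.

Lemma cosh_abs u : cosh `|u| = cosh u.
Proof.
rewrite /cosh; case: (lerP 0 u) => u0; first by rewrite ger0_norm.
by rewrite ltr0_norm// opprK addrC.
Qed.

Lemma coshN u : cosh (- u) = cosh u.
Proof. by rewrite -cosh_abs normrN cosh_abs. Qed.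

Lemma cosh_le u : cosh u <= expR `|u|.
Proof.
rewrite -cosh_abs /cosh ler_pdivrMr//.
have : expR (- `|u|) <= expR `|u| by rewrite ler_expR; have := normr_ge0 u; lra.
by lra.
Qed.

Lemma cosh_ge u : expR (`|u| - ln 2) <= cosh u.
Proof.
rewrite -cosh_abs expRB lnK ?posrE// /cosh ler_pM2r ?invr_gt0//.
by rewrite lerDl expR_ge0.
Qed.

Lemma sinh_le u : `|sinh u| <= expR `|u|.
Proof.
apply: le_trans (cosh_le u); rewrite /sinh /cosh normrM (@ger0_norm _ 2^-1) ?invr_ge0// ler_pM2r ?invr_gt0//.
by rewrite (le_trans (ler_normB _ _))// !ger0_norm// expR_ge0.
Qed.

Lemma sqr_cosh u : sinh u ^+ 2 = cosh u ^+ 2 - 1 :> R.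
Proof.
have := expRxMexpNx_1 u; rewrite /sinh /cosh => H.
rewrite !expr_div_n; set a := expR u in H *; set b := expR (- u) in H *.
have -> : (a + b) ^+ 2 = (a - b) ^+ 2 + 4 * (a * b) by ring.
by rewrite H; field.
Qed.

Lemma powexp_le (j : nat) x : 0 <= x -> x ^+ j * expR (- x) <= j`!%:R.
Proof.
move=> x0; rewrite expRN ler_pdivrMr ?expR_gt0//.
case: j => [|j]; first by rewrite expr0 fact0 mul1r; have := expR_ge1Dx x; lra.
have f0 : 0 < j.+1`!%:R :> R by rewrite ltr0n fact_gt0.
rewrite mulrC -ler_pdivrMr//; have := expR_ge1Dxn j x0; lra.
Qed.

Lemma expexp_le k : 0 < k ->
  exists2 C, 0 < C & forall z, expR (- expR z) <= C * expR (- (k * z)).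
Proof.
(* The constant is the maximum of [expR (k * z - expR z)], attained at [z = ln k]. *)
move=> k0; exists (expR (k * (ln k - 1))); first exact: expR_gt0.
move=> z; rewrite -expRD ler_expR lerNl.
have /(ler_wpM2l (ltW k0)) := expR_ge1Dx (z - ln k).
rewrite expRB lnK ?posrE// [_ * (_ / k)]mulrC divfK ?gt_eqF//.
by apply: le_trans; lra.
Qed.

(* A small rate k serves near y = -oo, a large one near y = +oo. *)
Lemma bessel_weight (j : nat) k : 0 < k ->
  exists2 C, 0 < C & forall y u,
    (expR y * cosh u) ^+ j * expR (- (expR y * cosh u)) <=
    C * expR (- (k * y)) * expR (- (k * `|u|)).
Proof.
move=> k0; have [C C0 HC] := expexp_le k0.
exists (2 ^+ j * j`!%:R * C * expR (k * (2 * ln 2))) => [|y u].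
  by rewrite !mulr_gt0 ?exprn_gt0 ?ltr0n ?fact_gt0 ?expR_gt0.
set t := expR y * cosh u.
have t0 : 0 < t by rewrite mulr_gt0 ?expR_gt0 ?cosh_gt0.
(* One half of the exponent absorbs the power [t ^+ j]. For the other half, [cosh u >= expR |u| / 2]
   gives [t / 2 >= expR (y + |u| - 2 ln 2)], and [expexp_le] applies. *)
have -> : t ^+ j * expR (- t) =
    2 ^+ j * ((t / 2) ^+ j * expR (- (t / 2))) * expR (- (t / 2)).
  rewrite -mulrA -[_ * _ * expR _]mulrA -expRD [(t / 2) ^+ j]expr_div_n.
  rewrite mulrA [2 ^+ j * _]mulrC divfK ?expf_neq0//; congr (_ * expR _); lra.
have H1 : (t / 2) ^+ j * expR (- (t / 2)) <= j`!%:R by apply: powexp_le; lra.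
have H2 : expR (- (t / 2)) <= C * expR (- (k * (y + `|u| - 2 * ln 2))).
  apply: le_trans (HC _); rewrite ler_expR lerN2.
  have -> : y + `|u| - 2 * ln 2 = y + ((`|u| - ln 2) - ln 2) by lra.
  rewrite expRD expRB lnK ?posrE// /t -mulrA ler_pM2l ?expR_gt0//.
  by rewrite ler_pM2r ?invr_gt0// cosh_ge.
have -> : 2 ^+ j * j`!%:R * C * expR (k * (2 * ln 2)) * expR (- (k * y)) *
    expR (- (k * `|u|)) =
  (2 ^+ j * j`!%:R) * (C * expR (- (k * (y + `|u| - 2 * ln 2)))).
  have -> : - (k * (y + `|u| - 2 * ln 2)) =
    k * (2 * ln 2) + (- (k * y)) + (- (k * `|u|)) by lra.
  by rewrite !expRD !mulrA.
apply: ler_pM => //; first by rewrite !mulr_ge0 ?exprn_ge0 ?expR_ge0//; lra.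
by rewrite ler_pM2l ?exprn_gt0.
Qed.

End Hyperbolic.

(** * The modified Bessel equation for integrals with a general weight *)

Section Bessel.
Context {R : realType}.
Notation mu := (@lebesgue_measure R).
Implicit Types (x y u w k : R) (phi : R -> R).

(** The weight [cosh (w * u)] gives twice the Macdonald function [K_w], the integral being over the
    whole line; [cos (2 * s * u)] gives the same with the imaginary order [2 i s]. A general [phi]
    treats both at once. *)
Definition KB phi x : R := \int[mu]_u (expR (- (x * cosh u)) * phi u).

Definition expbnd w phi := [/\ continuous phi, 0 <= w &
  exists M, forall u, `|phi u| <= M * expR (w * `|u|)].

Lemma expbnd_cosh w phi : expbnd w phi -> expbnd (1 + w) (fun u => cosh u * phi u).
Proof.
move=> [cf w0 [M HM]]; split; [by cts|by rewrite addr_ge0|].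
exists M => u; rewrite normrM ger0_norm; last by rewrite ltW ?cosh_gt0.
rewrite mulrDl mul1r expRD mulrCA; apply: ler_pM => //; last exact: cosh_le.
by rewrite ltW ?cosh_gt0.
Qed.

Lemma expbnd_sinh w phi : expbnd w phi -> expbnd (1 + w) (fun u => sinh u * phi u).
Proof.
move=> [cf w0 [M HM]]; split; [|by rewrite addr_ge0|].
  by apply: ctsM => //; rewrite /sinh; cts.
exists M => u; rewrite normrM mulrDl mul1r expRD mulrCA.
by apply: ler_pM => //; exact: sinh_le.
Qed.

Lemma expbndZ w c phi : expbnd w phi -> expbnd w (fun u => c * phi u).
Proof.
move=> [cf w0 [M HM]]; split; [by cts|by []|].
by exists (`|c| * M) => u; rewrite normrM -mulrA ler_wpM2l.
Qed.

Lemma expbnd_le w w' phi : w <= w' -> expbnd w phi -> expbnd w' phi.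
Proof.
move=> ww [cf w0 [M HM]]; split; [by []|by apply: le_trans ww|].
exists M => u; have M0 : 0 <= M.
  by have := le_trans (normr_ge0 _) (HM 0); rewrite pmulr_lge0 ?expR_gt0.
by rewrite (le_trans (HM u))// ler_wpM2l// ler_expR ler_wpM2r.
Qed.

Lemma expbndD w phi psi : expbnd w phi -> expbnd w psi ->
  expbnd w (fun u => phi u + psi u).
Proof.
move=> [cf w0 [M HM]] [cg _ [N HN]]; split; [by cts|by []|].
by exists (M + N) => u; rewrite mulrDl (le_trans (ler_normD _ _))// lerD.
Qed.

Lemma expbnd_coshw w : expbnd `|w| (fun u => cosh (w * u)).
Proof.
split => //; first by cts.
exists 1 => u; rewrite mul1r ger0_norm; last by rewrite ltW ?cosh_gt0.
by rewrite (le_trans (cosh_le _))// normrM.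
Qed.

Lemma expbnd_sinhw w : expbnd `|w| (fun u => sinh (w * u)).
Proof.
split => //; first by rewrite /sinh; cts.
by exists 1 => u; rewrite mul1r (le_trans (sinh_le _))// normrM.
Qed.

Lemma expbnd_cos w : expbnd 0 (fun u => cos (w * u)).
Proof.
by split => //; [cts|exists 1 => u; rewrite mul0r expR0 mulr1 cos_max].
Qed.

Lemma expbnd_sin w : expbnd 0 (fun u => sin (w * u)).
Proof.
by split => //; [cts|exists 1 => u; rewrite mul0r expR0 mulr1 sin_max].
Qed.

(** The rate [w + 1] in [bessel_weight] outweighs the growth of [phi] and leaves [expR (- |u|)].
    Uniformity in [x >= expR y] is what differentiation under the integral requires. *)
Lemma KB_dom w phi y : expbnd w phi -> exists2 C, 0 <= C &
  forall x u, expR y <= x -> `|expR (- (x * cosh u)) * phi u| <= C * expR (- (1 * `|u|)).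
Proof.
move=> [cf w0 [M HM]].
have M0 : 0 <= M.
  by have := le_trans (normr_ge0 _) (HM 0); rewrite pmulr_lge0 ?expR_gt0.
have k0 : 0 < w + 1 by rewrite ltr_wpDl.
have [C C0 HC] := bessel_weight 0 k0.
exists (C * expR (- ((w + 1) * y)) * M) => [|x u yx].
  by rewrite !mulr_ge0 ?expR_ge0// ltW.
have H : expR (- (x * cosh u)) <= C * expR (- ((w + 1) * y)) * expR (- ((w + 1) * `|u|)).
  apply: le_trans; last by have := HC y u; rewrite expr0 mul1r; apply.
  by rewrite ler_expR lerN2 ler_pM2r ?cosh_gt0.
rewrite normrM ger0_norm ?expR_ge0//.
have -> : C * expR (- ((w + 1) * y)) * M * expR (- (1 * `|u|)) =
  C * expR (- ((w + 1) * y)) * expR (- ((w + 1) * `|u|)) * (M * expR (w * `|u|)).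
  have -> : - (1 * `|u|) = - ((w + 1) * `|u|) + w * `|u| by lra.
  by rewrite expRD; ring.
by apply: ler_pM => //; exact: expR_ge0.
Qed.

Lemma KB_cts w phi x : expbnd w phi -> continuous (fun u => expR (- (x * cosh u)) * phi u).
Proof. by move=> [cf _ _]; cts. Qed.

Lemma KB_intg w phi x : 0 < x -> expbnd w phi ->
  intg (fun u => expR (- (x * cosh u)) * phi u).
Proof.
move=> x0 H; have [C C0 HC] := @KB_dom w phi (ln x) H.
apply: (@intg_expabs_le R _ C 1) => //; first exact: KB_cts H.
by move=> u; apply: HC; rewrite lnK ?posrE.
Qed.

Lemma KB_derive w phi x : 0 < x -> expbnd w phi ->
  is_derive x 1 (KB phi) (- KB (fun u => cosh u * phi u) x).
Proof.
move=> x0 H; have H1 := expbnd_cosh H.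
(* The majorant taken at [x / 2] is valid on the whole neighbourhood []x / 2, 2 * x[] of [x]. *)
have [C C0 HC] := @KB_dom _ _ (ln (x / 2)) H1.
have x20 : 0 < x / 2 by rewrite divr_gt0.
have Ix : `]x / 2, 2 * x[%classic x by rewrite /= in_itv/=; apply/andP; split; lra.
have pos z : `]x / 2, 2 * x[%classic z -> x / 2 < z.
  by rewrite /= in_itv/= => /andP[].
have dz z u : is_derive z (1 : R) (fun x => expR (- (x * cosh u)) * phi u)
    (- (expR (- (z * cosh u)) * (cosh u * phi u))).
  by der; ring.
have p1E z u : partial1of2 (fun x u => expR (- (x * cosh u)) * phi u) z u =
    - (expR (- (z * cosh u)) * (cosh u * phi u)).
  by rewrite partial1of2E; apply: derive_val; exact: dz.
have I1 z : `]x / 2, 2 * x[%classic z ->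
    mu.-integrable setT (EFin \o (fun u => expR (- (z * cosh u)) * phi u)).
  by move=> /pos zx; apply: (KB_intg _ H); apply: lt_trans zx.
have I2 z u : `]x / 2, 2 * x[%classic z -> setT u ->
    derivable ((fun x u => expR (- (x * cosh u)) * phi u)^~ u) z 1.
  by move=> _ _; have := dz z u.
have I3 : mu.-integrable setT (EFin \o (fun u : R => C * expR (- (1 * `|u|)))).
  by apply: intgZ; exact: intg_expabs.
have I4 z u : `]x / 2, 2 * x[%classic z -> setT u ->
  `|partial1of2 (fun x u => expR (- (x * cosh u)) * phi u) z u| <= C * expR (- (1 * `|u|)).
  move=> /pos zx _; rewrite p1E normrN; apply: HC.
  by rewrite lnK ?posrE// ltW.
have G0 (u : R) : 0 <= C * expR (- (1 * `|u|)) by rewrite mulr_ge0 ?expR_ge0.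
have D1 := @derivable_under_integral _ _ _ mu _ setT measurableT x _ _ Ix I1 I2 _ G0 I3 I4.
have D2 := @differentiation_under_integral _ _ _ mu _ setT measurableT x _ _ Ix I1 I2 _ G0 I3 I4.
apply: DeriveDef; first exact: D1.
rewrite -derive1E /KB [LHS]D2.
transitivity (\int[mu]_u (- 1 * (expR (- (x * cosh u)) * (cosh u * phi u)))).
  by apply: eq_Rintegral => u _; rewrite p1E mulN1r.
by rewrite RintZ ?mulN1r//; exact: KB_intg H1.
Qed.

Lemma cvg_expabs (F : R -> R) C k : 0 < k ->
  (forall u, `|F u| <= C * expR (- (k * `|u|))) ->
  F u @[u --> +oo] --> 0 /\ F u @[u --> -oo] --> 0.
Proof.
move=> k0 H.
have E0 : expR (- (k * x)) @[x --> +oo] --> (0 : R).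
  apply: (@cvg_comp _ _ _ (fun x => k * x) (fun x => expR (- x))); last exact: cvgr_expR.
  apply/cvgryPge => A; near=> x.
  by rewrite mulrC -ler_pdivrMr//; near: x; exact: nbhs_pinfty_ge.
have E1 : C * expR (- (k * x)) @[x --> +oo] --> (0 : R).
  by rewrite -(mulr0 C); apply: cvgM; [exact: cvg_cst|exact: E0].
have E2 : - (C * expR (- (k * x))) @[x --> +oo] --> (0 : R).
  by rewrite -[X in _ --> X]oppr0; apply: cvgN.
split.
  apply: (squeeze_cvgr _ E2 E1); near=> x.
  have x0 : 0 <= x by near: x; apply: nbhs_pinfty_ge; rewrite num_real.
  by rewrite -ler_norml; have := H x; rewrite (ger0_norm x0).
apply/cvgNy_compNP.
apply: (squeeze_cvgr _ E2 E1); near=> x.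
have x0 : 0 <= x by near: x; apply: nbhs_pinfty_ge; rewrite num_real.
by rewrite -ler_norml; have := H (- x); rewrite normrN (ger0_norm x0).
Unshelve. all: by end_near. Qed.

(** This is the modified Bessel equation [x^2 K'' + x K' = (l + x^2) K], since each derivative in
    [x] brings a factor [- cosh u]. Because [phi'' = l phi] and [sinh^2 = cosh^2 - 1], the
    difference of the two sides is the integral of the derivative of [F], the boundary term of two
    integrations by parts, which vanishes at both ends. *)
Lemma KB_ode w phi phi1 (l : R) x : 0 < x ->
  (forall u, is_derive u 1 phi (phi1 u)) ->
  (forall u, is_derive u 1 phi1 (l * phi u)) ->
  expbnd w phi -> expbnd w phi1 ->
  x ^+ 2 * KB (fun u => cosh u * (cosh u * phi u)) x -
    x * KB (fun u => cosh u * phi u) x = (l + x ^+ 2) * KB phi x.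
Proof.
move=> x0 d0 d1 H0 H1.
pose F u := expR (- (x * cosh u)) * (phi1 u + x * (sinh u * phi u)).
have HF : expbnd (1 + w) (fun u => phi1 u + x * (sinh u * phi u)).
  apply: expbndD; first by apply: expbnd_le H1; rewrite lerDr.
  by apply: expbndZ; exact: expbnd_sinh.
have [C C0 HC] := @KB_dom _ _ (ln x) HF.
have [Fy FNy] : F u @[u --> +oo] --> 0 /\ F u @[u --> -oo] --> 0.
  by apply: (@cvg_expabs _ C 1) => // u; apply: HC; rewrite lnK ?posrE.
pose e u := expR (- (x * cosh u)).
pose f u := (l + x ^+ 2) * (e u * phi u) + x * (e u * (cosh u * phi u)) -
    x ^+ 2 * (e u * (cosh u * (cosh u * phi u))).
have dF u : is_derive u 1 F (f u).
  rewrite /F; der.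
  have S := sqr_cosh u; rewrite /f /e.
  transitivity (expR (- (x * cosh u)) * (l * phi u + x * (cosh u * phi u) -
     x ^+ 2 * sinh u ^+ 2 * phi u)); first by ring.
  by rewrite S; ring.
have i0 := KB_intg x0 H0.
have i1 := KB_intg x0 (expbnd_cosh H0).
have i2 := KB_intg x0 (expbnd_cosh (expbnd_cosh H0)).
have cp : continuous phi by case: H0.
have I : \int[mu]_u f u = 0 - 0.
  apply: (@Rint_FTC _ F) => //; first by rewrite /f /e; cts.
  by apply: intgB; [apply: intgD|]; apply: intgZ.
move: I; rewrite /f RintB; [|by apply: intgD; exact: intgZ|exact: intgZ].
rewrite RintD; [|exact: intgZ|exact: intgZ].
rewrite !RintZ// /KB subrr -/(e _) => I; lra.
Qed.

(** In the variable [y = ln x] the Bessel equation has no first-order term, so the derivative of a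
    Wronskian contains no derivatives of the functions. *)
Definition KBlog phi y := KB phi (expR y).
Definition dKBlog phi y := - (expR y * KB (fun u => cosh u * phi u) (expR y)).

Lemma KBlog_derive w phi y : expbnd w phi -> is_derive y 1 (KBlog phi) (dKBlog phi y).
Proof.
move=> H; have D := KB_derive (expR_gt0 y) H.
have := dv_comp D (is_derive_expR y).
by move=> h; apply: (dv_eq h); rewrite /dKBlog; ring.
Qed.

Lemma dKBlog_derive w phi phi1 l y :
  (forall u, is_derive u 1 phi (phi1 u)) ->
  (forall u, is_derive u 1 phi1 (l * phi u)) ->
  expbnd w phi -> expbnd w phi1 ->
  is_derive y 1 (dKBlog phi) ((l + expR y ^+ 2) * KBlog phi y).
Proof.
move=> d0 d1 H0 H1.
have D := KBlog_derive y (expbnd_cosh H0).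
have := dvN (dvM (is_derive_expR y) D).
move=> h; apply: (dv_eq h); rewrite -(KB_ode (expR_gt0 y) d0 d1 H0 H1) /dKBlog /KBlog.
by ring.
Qed.

(** The factors [expR y ^+ j] and [cosh u ^+ j] combine to the power that [bessel_weight] absorbs.
    The case [j = 0] serves the function, [j = 1] its derivative in [y]. *)
Lemma KBlog_bound w k phi (j : nat) : w < k -> expbnd w phi ->
  exists2 C, 0 <= C & forall y,
   expR y ^+ j * `|KB (fun u => cosh u ^+ j * phi u) (expR y)| <= C * expR (- (k * y)).
Proof.
move=> wk [cf w0 [M HM]].
have M0 : 0 <= M.
  by have := le_trans (normr_ge0 _) (HM 0); rewrite pmulr_lge0 ?expR_gt0.
have k0 : 0 < k by apply: le_lt_trans wk.
have [C C0 HC] := bessel_weight j k0.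
pose J := \int[mu]_u expR (- ((k - w) * `|u|)).
have kw : 0 < k - w by rewrite subr_gt0.
exists (C * M * J) => [|y].
  by rewrite !mulr_ge0 ?(ltW C0)//; apply: Rintegral_ge0 => u _; exact: expR_ge0.
rewrite -{1}[expR y]ger0_norm ?expR_ge0// -normrX -normrM /KB.
have HB u : `|expR y ^+ j * (expR (- (expR y * cosh u)) * (cosh u ^+ j * phi u))| <=
   C * M * expR (- (k * y)) * expR (- ((k - w) * `|u|)).
  have -> : expR y ^+ j * (expR (- (expR y * cosh u)) * (cosh u ^+ j * phi u)) =
    ((expR y * cosh u) ^+ j * expR (- (expR y * cosh u))) * phi u.
    by rewrite [(expR y * _) ^+ _]exprMn; move: (expR y ^+ j) (cosh u ^+ j) => A B; ring.
  have -> : C * M * expR (- (k * y)) * expR (- ((k - w) * `|u|)) =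
    (C * expR (- (k * y)) * expR (- (k * `|u|))) * (M * expR (w * `|u|)).
    have -> : - ((k - w) * `|u|) = - (k * `|u|) + w * `|u| by lra.
    by rewrite expRD; ring.
  rewrite normrM; apply: ler_pM => //.
  rewrite ger0_norm// mulr_ge0 ?expR_ge0// exprn_ge0// mulr_ge0 ?expR_ge0//.
  by rewrite ltW ?cosh_gt0.
have cF : continuous (fun u => expR y ^+ j * (expR (- (expR y * cosh u)) * (cosh u ^+ j * phi u))).
  by cts.
have iG := intgZ (C * M * expR (- (k * y))) (intg_expabs kw).
have iF := intg_le cF HB iG.
have <- : \int[mu]_u (expR y ^+ j * (expR (- (expR y * cosh u)) * (cosh u ^+ j * phi u))) =
  expR y ^+ j * \int[mu]_u (expR (- (expR y * cosh u)) * (cosh u ^+ j * phi u)).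
  apply: RintZ; apply: (intg_eq _ (intgZ (expR y ^+ j)^-1 iF)) => u.
  by rewrite mulKf// expf_neq0// gt_eqF// expR_gt0.
apply: le_trans (Rint_norm_le (continuous_measurable_fun cF) iG HB) _.
rewrite RintZ; last exact: intg_expabs.
by rewrite -/J mulrAC.
Qed.

Lemma KBlog_le w k phi : w < k -> expbnd w phi -> exists2 C, 0 <= C & forall y,
   `|KBlog phi y| <= C * expR (- (k * y)) /\ `|dKBlog phi y| <= C * expR (- (k * y)).
Proof.
move=> wk H; have [C C0 HC] := KBlog_bound 0 wk H; have [D D0 HD] := KBlog_bound 1 wk H.
exists (C + D) => [|y]; first by rewrite addr_ge0.
have e0 := expR_ge0 (- (k * y)).
split; rewrite mulrDl.
  have := HC y; rewrite expr0 mul1r => h; rewrite /KBlog.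
  have <- : (fun u => cosh u ^+ 0 * phi u) = phi by apply/funext => u; rewrite expr0 mul1r.
  by rewrite (le_trans h)// lerDl mulr_ge0.
have := HD y; rewrite expr1 => h; rewrite /dKBlog normrN normrM ger0_norm ?expR_ge0//.
have <- : (fun u => cosh u ^+ 1 * phi u) = (fun u => cosh u * phi u) by apply/funext => u; rewrite expr1.
by rewrite (le_trans h)// lerDr mulr_ge0.
Qed.

Lemma KBlog_cts w phi : expbnd w phi -> continuous (KBlog phi).
Proof. by move=> H; apply: (@dv_cts R _ (dKBlog phi)) => y; exact: (KBlog_derive y H). Qed.

End Bessel.

(** * Exponential bounds and the Gamma integral *)

Section Bounds.
Context {R : realType}.
Implicit Types (P : R -> Prop) (f g : R -> R) (r s : R).

Definition bnd P r f := exists C, forall y, P y -> `|f y| <= C * expR (r * y).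

Lemma bnd_abs P r f : bnd P r f ->
  exists2 C, 0 <= C & forall y, P y -> `|f y| <= C * expR (r * y).
Proof.
move=> [C H]; exists `|C| => // y /H h; rewrite (le_trans h)//.
by rewrite ler_pM2r ?expR_gt0// ler_norm.
Qed.

Lemma bndD P r f g : bnd P r f -> bnd P r g -> bnd P r (fun y => f y + g y).
Proof.
move=> [C H] [D K]; exists (C + D) => y Py; rewrite mulrDl.
by rewrite (le_trans (ler_normD _ _))// lerD ?H ?K.
Qed.

Lemma bndM P r s f g : bnd P r f -> bnd P s g -> bnd P (r + s) (fun y => f y * g y).
Proof.
move=> /bnd_abs[C C0 H] /bnd_abs[D D0 K]; exists (C * D) => y Py.
by rewrite mulrDl expRD normrM mulrACA; apply: ler_pM => //; [exact: H|exact: K].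
Qed.

Lemma bndZ P r c f : bnd P r f -> bnd P r (fun y => c * f y).
Proof.
by move=> [C H]; exists (`|c| * C) => y Py; rewrite normrM -mulrA ler_wpM2l// H.
Qed.

Lemma bndN P r f : bnd P r f -> bnd P r (fun y => - f y).
Proof. by move=> [C H]; exists C => y Py; rewrite normrN H. Qed.

Lemma bnd_expR P r : bnd P r (fun y => expR (r * y)).
Proof. by exists 1 => y _; rewrite mul1r ger0_norm// expR_ge0. Qed.

Lemma bnd_eq P r f g : (forall y, P y -> f y = g y) -> bnd P r f -> bnd P r g.
Proof. by move=> fg [C H]; exists C => y Py; rewrite -fg// H. Qed.

Lemma bnd_sum P r (a n : nat) (F : nat -> R -> R) :
  (forall k, (a <= k < n)%N -> bnd P r (F k)) ->
  bnd P r (fun y => \sum_(a <= k < n) F k y).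
Proof.
elim: n => [_|n IH H].
  by exists 0 => y _; rewrite big_geq// normr0 mul0r.
have [an|na] := leqP a n; last first.
  by exists 0 => y _; rewrite big_geq// normr0 mul0r.
apply: (@bnd_eq _ _ (fun y => \sum_(a <= k < n) F k y + F n y)).
  by move=> y _; rewrite big_nat_recr.
apply: bndD; last by apply: H; rewrite an ltnSn.
by apply: IH => k /andP[ak kn]; apply: H; rewrite ak (ltn_trans kn).
Qed.

Lemma bnd_leN r s f : s <= r -> bnd (fun y => y <= 0) r f -> bnd (fun y => y <= 0) s f.
Proof.
move=> sr /bnd_abs[C C0 H]; exists C => y y0; rewrite (le_trans (H y y0))//.
by rewrite ler_wpM2l// ler_expR ler_wnM2r.
Qed.

Lemma bnd_leP r s f : r <= s -> bnd (fun y => 0 <= y) r f -> bnd (fun y => 0 <= y) s f.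
Proof.
move=> rs /bnd_abs[C C0 H]; exists C => y y0; rewrite (le_trans (H y y0))//.
by rewrite ler_wpM2l// ler_expR ler_wpM2r.
Qed.

Lemma bnd_inv P r f (c : R) : 0 < c -> (forall y, P y -> c * expR (r * y) <= f y) ->
  bnd P (- r) (fun y => (f y)^-1).
Proof.
move=> c0 H; exists c^-1 => y Py; have h := H y Py.
have f0 : 0 < f y by apply: lt_le_trans h; rewrite mulr_gt0 ?expR_gt0.
rewrite normfV gtr0_norm// mulNr expRN -invfM lef_pV2 ?posrE//.
by rewrite mulr_gt0 ?expR_gt0.
Qed.

Lemma nincr_derive f df : (forall y : R, is_derive y 1 f (df y)) ->
  (forall y, y <= 0 -> df y <= 0) -> forall x y, x <= y -> y <= 0 -> f y <= f x.
Proof.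
move=> d n; apply: ler0_derive1_nincrNy.
- by move=> x _; have := d x.
- move=> x; rewrite in_itv/= => x0; rewrite derive1E.
  by rewrite (@derive_val _ _ _ _ _ _ _ (d x)) n// ltW.
- by apply: continuous_subspaceT; exact: dv_cts d.
Qed.

(** The bound on [df] grows towards -oo, so integrating back from 0 keeps its rate and adds only the
    value at 0. The monotonicity of [f] and of [- f], each plus [C / b * expR (- b * y)], stands in
    for the integral. *)
Lemma bnd_primitiveN f df (b : R) : 0 < b -> (forall y : R, is_derive y 1 f (df y)) ->
  bnd (fun y => y <= 0) (- b) df -> bnd (fun y => y <= 0) (- b) f.
Proof.
move=> b0 d /bnd_abs[C C0 H]; exists (`|f 0| + C / b) => y y0.
have bb : b != 0 by rewrite gt_eqF.
have e1 : 1 <= expR (- b * y) by rewrite -[leLHS]expR0 ler_expR mulNr oppr_ge0 mulr_ge0_le0// ltW.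
have A : f 0 + C / b <= f y + C / b * expR (- b * y).
  have := @nincr_derive (fun y => f y + C / b * expR (- b * y))
    (fun y => df y + - (C * expR (- b * y))).
  move=> /(_ _ _ y 0 y0 (lexx 0)); rewrite mulr0 expR0 mulr1; apply.
    by move=> x; der; field.
  by move=> x x0; have := H x x0; rewrite ler_norml => /andP[_]; lra.
have B : - f 0 + C / b <= - f y + C / b * expR (- b * y).
  have := @nincr_derive (fun y => - f y + C / b * expR (- b * y))
    (fun y => - df y + - (C * expR (- b * y))).
  move=> /(_ _ _ y 0 y0 (lexx 0)); rewrite mulr0 expR0 mulr1; apply.
    by move=> x; der; field.
  by move=> x x0; have := H x x0; rewrite ler_norml => /andP[+ _]; lra.
have Cb : 0 <= C / b by rewrite divr_ge0// ltW.
rewrite mulrDl; apply: (@le_trans _ _ (`|f 0| + C / b * expR (- b * y))); last first.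
  by rewrite lerD2r ler_peMr.
by rewrite ler_norml; apply/andP; split;
  have := ler_norm (f 0); have := ler_norm (- f 0); rewrite normrN; lra.
Qed.

Lemma le_expR_small (B g e y : R) : 0 < e -> 0 < g -> 0 <= B ->
  exists2 x, x <= y & B * expR (g * x) <= e.
Proof.
move=> e0 g0 B0; have B1 : 0 < B + 1 by rewrite ltr_wpDl.
exists (Num.min y (ln (e / (B + 1)) / g)); first by rewrite ge_min lexx.
apply: (@le_trans _ _ ((B + 1) * expR (ln (e / (B + 1))))); last first.
  by rewrite lnK ?posrE ?divr_gt0// mulrC divfK// gt_eqF.
apply: ler_pM; rewrite ?expR_ge0 ?lerDl//.
rewrite ler_expR (@le_trans _ _ (g * (ln (e / (B + 1)) / g)))//.
  by apply: ler_wpM2l; [exact: ltW|rewrite ge_min lexx orbT].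
by rewrite mulrC divfK// gt_eqF.
Qed.

(** Here the bound on [df] is integrable at -oo, and [f] is recovered from its limit there. The rate
    [g], however weak, serves to show that this limit is 0; the rate [b] of the derivative then
    replaces it. *)
Lemma bnd_primitiveP f df (b g : R) : 0 < b -> 0 < g ->
  (forall y : R, is_derive y 1 f (df y)) ->
  bnd (fun y => y <= 0) g f ->
  bnd (fun y => y <= 0) b df -> bnd (fun y => y <= 0) b f.
Proof.
move=> b0 g0 d /bnd_abs[B B0 K] /bnd_abs[C C0 H]; exists (C / b) => y y0.
have bb : b != 0 by rewrite gt_eqF.
have Cb : 0 <= C / b by rewrite divr_ge0// ltW.
have M x : x <= y -> f y - C / b * expR (b * y) <= f x - C / b * expR (b * x).
  move=> xy; apply: (@nincr_derive (fun y => f y - C / b * expR (b * y))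
    (fun y => df y - (C * expR (b * y)))) => //.
    by move=> z; der; field.
  by move=> z z0; have := H z z0; rewrite ler_norml => /andP[_]; lra.
have N x : x <= y -> - f y - C / b * expR (b * y) <= - f x - C / b * expR (b * x).
  move=> xy; apply: (@nincr_derive (fun y => - f y - C / b * expR (b * y))
    (fun y => - df y - (C * expR (b * y)))) => //.
    by move=> z; der; field.
  by move=> z z0; have := H z z0; rewrite ler_norml => /andP[+ _]; lra.
apply/ler_addgt0Pl => e e0.
have [x xy xe] := le_expR_small y e0 g0 B0.
have := M x xy; have := N x xy; have := K x (le_trans xy y0).
have ex : 0 <= C / b * expR (b * x) by rewrite mulr_ge0 ?expR_ge0.
rewrite !ler_norml => /andP[k1 k2] h1 h2; apply/andP; split; lra.
Qed.

End Bounds.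

(** * Euler's integral in the variable [v = ln t] *)

Section GammaIntegral.
Context {R : realType}.
Notation mu := (@lebesgue_measure R).
Implicit Types (p v z y : R).

Lemma gam_weight p : 0 < p -> exists2 k, 0 < k & exists2 C, 0 <= C &
  forall v, expR (p * v) * expR (- (expR v / 2)) <= C * expR (- (k * `|v|)).
Proof.
move=> p0; have p1 : 0 < p + 1 by rewrite addr_gt0.
have [C C0 HC] := expexp_le p1.
set B := expR ((p + 1) * ln 2).
(* For [v < 0] the factor [expR (p * v)] decays at rate [p]. For [v >= 0] the double exponential,
   used at rate [p + 1], leaves rate 1. *)
exists (Num.min p 1); first by rewrite lt_min p0 ltr01.
exists (1 + C * B); first by rewrite addr_ge0// mulr_ge0 ?expR_ge0 ?ltW.
move=> v; case: (lerP 0 v) => v0.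
  rewrite ger0_norm//.
  have -> : expR v / 2 = expR (v - ln 2) by rewrite expRB lnK ?posrE.
  apply: (@le_trans _ _ (expR (p * v) * (C * expR (- ((p + 1) * (v - ln 2)))))).
    by rewrite ler_wpM2l ?expR_ge0.
  have -> : expR (p * v) * (C * expR (- ((p + 1) * (v - ln 2)))) =
     C * B * expR (- v).
    rewrite /B mulrCA -expRD -mulrA -expRD; congr (_ * expR _); lra.
  apply: ler_pM; rewrite ?expR_ge0//.
  - by rewrite mulr_ge0 ?expR_ge0 ?ltW.
  - by rewrite lerDr.
  - by rewrite ler_expR lerN2 -[leRHS]mul1r ler_wpM2r// ge_min lexx orbT.
rewrite ltr0_norm// mulrN opprK.
apply: (@le_trans _ _ (expR (p * v) * 1)).
  rewrite ler_wpM2l ?expR_ge0// expR_le1 oppr_le0 divr_ge0 ?expR_ge0//.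
rewrite mulr1 -[leLHS]mul1r; apply: ler_pM; rewrite ?expR_ge0//.
  by rewrite lerDl mulr_ge0 ?expR_ge0 ?ltW.
by rewrite ler_expR; apply: ler_wnM2r; [exact: ltW|rewrite ge_min lexx].
Qed.

(** Euler's integral for [Gamma(p)] after [t = expR v]. *)
Definition gam p : R := \int[mu]_v (expR (p * v) * expR (- expR v)).

Lemma gam_half_intg p : 0 < p -> intg (fun v => expR (p * v) * expR (- (expR v / 2))).
Proof.
move=> p0; have [k k0 [C C0 HC]] := gam_weight p0.
apply: (intg_expabs_le k0) (fun v => _) => [|v]; first by cts.
by rewrite ger0_norm ?mulr_ge0 ?expR_ge0//; exact: HC.
Qed.

Lemma gam_intg p : 0 < p -> intg (fun v => expR (p * v) * expR (- expR v)).
Proof.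
move=> /gam_half_intg; apply: intg_le; first by cts.
move=> v; rewrite ger0_norm ?mulr_ge0 ?expR_ge0// ler_wpM2l ?expR_ge0//.
by rewrite ler_expR lerN2; have := expR_ge0 v; lra.
Qed.

Lemma gam_gt0 p : 0 < p -> 0 < gam p.
Proof.
move=> p0; apply: Rint_gt0; [by cts|exact: gam_intg|].
by move=> v; rewrite mulr_gt0 ?expR_gt0.
Qed.

Lemma gamS p : 0 < p -> gam (p + 1) = p * gam p.
Proof.
move=> p0; have p1 : 0 < p + 1 by rewrite addr_gt0.
have [k k0 [C C0 HC]] := gam_weight p0.
have [Fy FNy] : expR (p * v) * expR (- expR v) @[v --> +oo] --> (0 : R) /\
    expR (p * v) * expR (- expR v) @[v --> -oo] --> (0 : R).
  apply: (@cvg_expabs _ _ C k) => // v; apply: le_trans (HC v).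
  rewrite ger0_norm ?mulr_ge0 ?expR_ge0// ler_wpM2l ?expR_ge0//.
  by rewrite ler_expR lerN2; have := expR_ge0 v; lra.
have dF v : is_derive v 1 (fun v => expR (p * v) * expR (- expR v))
   (p * (expR (p * v) * expR (- expR v)) - expR ((p + 1) * v) * expR (- expR v)).
  by der; rewrite mulrDl mul1r expRD; ring.
have := Rint_FTC dF _ _ Fy FNy.
rewrite RintB ?RintZ; [|exact: gam_intg|by apply: intgZ; exact: gam_intg|exact: gam_intg].
rewrite -/(gam p) -/(gam (p + 1)) subrr => H.
suff : p * gam p - gam (p + 1) = 0 by move/eqP; rewrite subr_eq0 => /eqP.
apply: H; first by cts.
by apply: intgB; [apply: intgZ|]; exact: gam_intg.
Qed.

(** A second cut-off, at -oo, deforms Euler's integral into a Macdonald function: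
    [2 K_p(x) = (x / 2)^{-p} gamz p (x^2 / 4)]. At [z = 0] it is [gam p]. *)
Definition gamz p z : R := \int[mu]_v (expR (p * v) * expR (- (expR v + z * expR (- v)))).

Lemma gamz_intg p z : 0 < p -> 0 <= z ->
  intg (fun v => expR (p * v) * expR (- (expR v + z * expR (- v)))).
Proof.
move=> p0 z0; apply: intg_le (gam_intg p0); first by cts.
move=> v; rewrite ger0_norm ?mulr_ge0 ?expR_ge0// ler_wpM2l ?expR_ge0//.
by rewrite ler_expR lerN2 lerDl mulr_ge0 ?expR_ge0.
Qed.

Lemma gamz_le p z : 0 < p -> 0 <= z -> gamz p z <= gam p.
Proof.
move=> p0 z0; apply: Rint_le; [exact: gamz_intg|exact: gam_intg|].
move=> v; rewrite ler_wpM2l ?expR_ge0//.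
by rewrite ler_expR lerN2 lerDl mulr_ge0 ?expR_ge0.
Qed.

Lemma gamz_decr p z z' : 0 < p -> 0 <= z -> z <= z' -> gamz p z' <= gamz p z.
Proof.
move=> p0 z0 zz; apply: Rint_le; [apply: gamz_intg => //; exact: le_trans zz|exact: gamz_intg|].
move=> v; rewrite ler_wpM2l ?expR_ge0//.
by rewrite ler_expR lerN2 lerD2l ler_wpM2r ?expR_ge0.
Qed.

Lemma gamz_gt0 p z : 0 < p -> 0 <= z -> 0 < gamz p z.
Proof.
move=> p0 z0; apply: Rint_gt0; [by cts|exact: gamz_intg|].
by move=> v; rewrite mulr_gt0 ?expR_gt0.
Qed.

(** The integrand of the difference carries [1 - exp (- t)] with [t = expR (y - v)], which is at
    most [t^k] for [0 < k <= 1]. The power [t^k] contributes [expR (k * y)] and lowers the exponent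
    [p] to [p - k]. *)
Lemma gamz_near p (k : R) y : 0 < k -> k < p -> k <= 1 ->
  gam p - gamz p (expR y) <= expR (k * y) * gam (p - k).
Proof.
move=> k0 kp k1; have p0 : 0 < p by apply: lt_trans kp.
have pk : 0 < p - k by rewrite subr_gt0.
rewrite /gam /gamz -RintB; [|exact: gam_intg|by apply: gamz_intg; rewrite ?expR_ge0].
rewrite -RintZ; last exact: gam_intg.
apply: Rint_le.
- by apply: intgB; [exact: gam_intg|by apply: gamz_intg; rewrite ?expR_ge0].
- by apply: intgZ; exact: gam_intg.
move=> v.
have -> : expR (- (expR v + expR y * expR (- v))) =
    expR (- expR v) * expR (- expR (y - v)) by rewrite -!expRD opprD.
have H : 1 - expR (- expR (y - v)) <= expR (k * (y - v)).
  case: (lerP 0 (y - v)) => yv.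
    apply: (@le_trans _ _ 1); first by rewrite lerBlDr lerDl expR_ge0.
    by rewrite -[leLHS]expR0 ler_expR mulr_ge0// ltW.
  apply: (@le_trans _ _ (expR (y - v))).
    by have := expR_ge1Dx (- expR (y - v)); lra.
  by rewrite ler_expR -[leLHS]mul1r; apply: ler_wnM2r; [exact: ltW|].
have -> : expR (k * y) * (expR ((p - k) * v) * expR (- expR v)) =
   (expR (p * v) * expR (- expR v)) * expR (k * (y - v)).
  rewrite -!expRD; congr expR; lra.
have -> : expR (p * v) * expR (- expR v) -
   expR (p * v) * (expR (- expR v) * expR (- expR (y - v))) =
  (expR (p * v) * expR (- expR v)) * (1 - expR (- expR (y - v))) by ring.
by rewrite ler_wpM2l// mulr_ge0 ?expR_ge0.
Qed.

End GammaIntegral.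

(** * Behaviour of the regularized integrand near zero *)

Section MacdonaldNearZero.
Context {R : realType}.
Notation mu := (@lebesgue_measure R).
Implicit Types (nu w y u v : R) (W : R -> R).

Notation KC w := (KBlog (fun u => cosh (w * u))).
Notation KC1 w := (dKBlog (fun u => cosh (w * u))).
Notation nonpos := (fun y : R => y <= 0).
Notation nonneg := (fun y : R => 0 <= y).

(* Substituting u = v - y + ln 2 turns e^y cosh u into e^v + (e^{2y}/4) e^{-v}. *)
Lemma Macdonald_shift W nu y : continuous W ->
  intg (fun u => W (expR y * cosh u) * expR (nu * u)) ->
  \int[mu]_u (W (expR y * cosh u) * cosh (nu * u)) =
  expR (- (nu * (y - ln 2))) *
  \int[mu]_v (expR (nu * v) * W (expR v + expR (2 * (y - ln 2)) * expR (- v))).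
Proof.
move=> cW jW.
have cF : continuous (fun u => W (expR y * cosh u) * expR (nu * u)).
  by apply: ctsM; [apply: cts_comp => //|]; cts.
have [jN IN] := Rint_opp cF jW.
(* The factor [W (expR y * cosh u)] is even in [u], so [cosh (nu * u)] may be replaced by one
   exponential, which the shift only rescales. *)
have -> : \int[mu]_u (W (expR y * cosh u) * cosh (nu * u)) =
    \int[mu]_u (W (expR y * cosh u) * expR (nu * u)).
  transitivity (\int[mu]_u (2^-1 * (W (expR y * cosh u) * expR (nu * u) +
      W (expR y * cosh (- u)) * expR (nu * - u)))).
    by apply: eq_Rintegral => u _; rewrite coshN {2}/cosh mulrN; field.
  by rewrite RintZ ?RintD// ?IN; [field|exact: intgD].
have [js Is] := Rint_shift (ln 2 - y) cF jW.
rewrite -Is -RintZ.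
  apply: eq_Rintegral => v _; rewrite mulrA -expRD [RHS]mulrC.
  congr (W _ * expR _); last by ring.
  have a2 : expR (ln 2) = 2 :> R by rewrite lnK ?posrE.
  rewrite /cosh mulrA mulrDr -!expRD mulrDl.
  congr (_ + _).
    rewrite (_ : y + _ = v + ln 2); last by ring.
    by rewrite [expR (_ + ln 2)]expRD a2 mulfK.
  rewrite (_ : y + _ = (2 * (y - ln 2) + - v) + ln 2); last by ring.
  by rewrite [expR (_ + ln 2)]expRD a2 mulfK.
apply: (intg_eq _ (intgZ (expR (nu * (y - ln 2))) js)) => v.
rewrite [RHS]mulrC mulrCA; congr (_ * _).
  congr W; rewrite /cosh mulrA mulrDr -!expRD mulrDl.
  have a2 : expR (ln 2) = 2 :> R by rewrite lnK ?posrE.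
  congr (_ + _).
    rewrite (_ : y + _ = v + ln 2); last by ring.
    by rewrite [expR (_ + ln 2)]expRD a2 mulfK.
  rewrite (_ : y + _ = (2 * (y - ln 2) + - v) + ln 2); last by ring.
  by rewrite [expR (_ + ln 2)]expRD a2 mulfK.
by rewrite -expRD; congr expR; ring.
Qed.

Lemma expbnd_exp nu : expbnd `|nu| (fun u => expR (nu * u)).
Proof.
split => //; first by cts.
by exists 1 => u; rewrite mul1r ger0_norm ?expR_ge0// ler_expR -normrM ler_norm.
Qed.

Lemma KC_gamz nu y : KC nu y =
  expR (- (nu * (y - ln 2))) * gamz nu (expR (2 * (y - ln 2))).
Proof.
rewrite /KBlog /KB (@Macdonald_shift (fun t => expR (- t))) //; first by cts.
exact: KB_intg (expR_gt0 y) (expbnd_exp nu).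
Qed.

Lemma KC_gt0 nu y : 0 < nu -> 0 < KC nu y.
Proof. by move=> n0; rewrite KC_gamz mulr_gt0 ?expR_gt0 ?gamz_gt0 ?expR_ge0. Qed.

Lemma KC_lower nu : 0 < nu -> exists2 c, 0 < c &
  forall y, y <= 0 -> c * expR (- nu * y) <= KC nu y.
Proof.
(* [gamz nu] decreases in its second argument, which for [y <= 0] is largest at [y = 0]. *)
move=> n0; exists (expR (nu * ln 2) * gamz nu (expR (2 * (0 - ln 2)))).
  by rewrite mulr_gt0 ?expR_gt0 ?gamz_gt0 ?expR_ge0.
move=> y y0; rewrite KC_gamz mulrAC -expRD.
have -> : nu * ln 2 + - nu * y = - (nu * (y - ln 2)) by ring.
apply: ler_wpM2l; first exact: expR_ge0.
apply: gamz_decr; rewrite ?expR_ge0 ?ler_expR//.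
by rewrite ler_pM2l// lerD2r.
Qed.

Lemma KC_upper nu : 0 < nu -> bnd nonpos (- nu) (KC nu).
Proof.
move=> n0; exists (expR (nu * ln 2) * gam nu) => y _.
rewrite ger0_norm; last by rewrite ltW ?KC_gt0.
rewrite KC_gamz mulrAC -expRD.
have -> : nu * ln 2 + - nu * y = - (nu * (y - ln 2)) by ring.
by rewrite ler_wpM2l ?expR_ge0// gamz_le ?expR_ge0.
Qed.

Lemma KC1_upper nu : 0 < nu -> bnd nonpos (- nu) (KC1 nu).
Proof.
move=> n0; pose J := \int[mu]_v (expR (nu * v) * expR (- (expR v / 2))).
exists (expR (nu * ln 2) * (2 * J)) => y _.
pose W (t : R) := t * expR (- t).
have cW : continuous W by rewrite /W; cts.
have jW : intg (fun u => W (expR y * cosh u) * expR (nu * u)).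
  apply: (intg_eq _ (intgZ (expR y) (KB_intg (expR_gt0 y) (expbnd_cosh (expbnd_exp nu))))).
  by move=> u; rewrite /W; ring.
have E : KC1 nu y = - \int[mu]_u (W (expR y * cosh u) * cosh (nu * u)).
  rewrite /dKBlog /KB -RintZ; last first.
    exact: KB_intg (expR_gt0 y) (expbnd_cosh (expbnd_coshw nu)).
  by congr (- _); apply: eq_Rintegral => u _; rewrite /W; ring.
rewrite E normrN (Macdonald_shift cW jW) normrM ger0_norm ?expR_ge0//.
rewrite mulrAC -expRD.
have -> : nu * ln 2 + - nu * y = - (nu * (y - ln 2)) by ring.
rewrite ler_wpM2l ?expR_ge0// -RintZ; last exact: gam_half_intg.
have j2 : intg (fun v => 2 * (expR (nu * v) * expR (- (expR v / 2)))).
  by apply: intgZ; exact: gam_half_intg.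
apply: Rint_norm_le => //.
  apply: continuous_measurable_fun; apply: ctsM; first by cts.
  by apply: cts_comp => //; cts.
move=> v; set t := expR v + _.
have tv : expR v <= t by rewrite lerDl mulr_ge0 ?expR_ge0.
have t0 : 0 <= t by apply: le_trans tv; exact: expR_ge0.
have Wt : 0 <= W t by rewrite mulr_ge0 ?expR_ge0.
rewrite [leRHS]mulrCA ger0_norm; last by apply: mulr_ge0; first exact: expR_ge0.
apply: ler_wpM2l; first exact: expR_ge0.
(* Half of the exponent bounds the factor [t] by 2; the other half keeps the decay in [v], since
   [t >= expR v]. *)
have : t / 2 * expR (- (t / 2)) <= 1.
  by have := @powexp_le R 1 (t / 2); rewrite expr1 factS fact0 muln1; apply; lra.
have : expR (- (t / 2)) <= expR (- (expR v / 2)) by rewrite ler_expR; lra.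
have := expR_ge0 (- (t / 2)).
rewrite /W (_ : - t = - (t / 2) + - (t / 2)); last by lra.
rewrite expRD; set E1 := expR (- (t / 2)); set E2 := expR (- (expR v / 2)).
by move=> h0 h1 h2; nra.
Qed.

(** The constant inverts the leading coefficient [2^nu Gamma(nu)] of [KC nu] at -oo. The relative
    error is that of [gamz_near] at [z = x^2 / 4], hence the gain [2 k], where [k] is chosen to meet
    both [k < nu] and [k <= 1]. *)
Lemma KC_leading nu : 0 < nu -> exists2 g : R, 0 < g & bnd nonpos (g - nu)
  (fun y => expR (- nu * y) - (expR (nu * ln 2) * gam nu)^-1 * KC nu y).
Proof.
move=> n0.
pose k := Num.min (nu / 2) 1.
have k0 : 0 < k by rewrite /k lt_min ltr01 andbT divr_gt0.
have k1 : k <= 1 by rewrite /k ge_min lexx orbT.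
have kn : k < nu by rewrite (@le_lt_trans _ _ (nu / 2))//; [rewrite /k ge_min lexx|lra].
exists (2 * k); first by rewrite mulr_gt0.
exists (gam (nu - k) / gam nu * expR (- (2 * k * ln 2))) => y _.
have g0 := gam_gt0 n0.
have -> : expR (- nu * y) - (expR (nu * ln 2) * gam nu)^-1 * KC nu y =
   expR (- nu * y) / gam nu * (gam nu - gamz nu (expR (2 * (y - ln 2)))).
  rewrite KC_gamz (_ : - (nu * (y - ln 2)) = - nu * y + nu * ln 2); last by ring.
  have e0 := expR_gt0 (nu * ln 2).
  by rewrite expRD; field; rewrite !gt_eqF.
have g1 : 0 <= gam nu - gamz nu (expR (2 * (y - ln 2))).
  by rewrite subr_ge0 gamz_le ?expR_ge0.
rewrite ger0_norm; last by rewrite !mulr_ge0 ?expR_ge0// invr_ge0 ltW.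
have H := gamz_near (2 * (y - ln 2)) k0 kn k1.
apply: (@le_trans _ _ (expR (- nu * y) / gam nu *
   (expR (k * (2 * (y - ln 2))) * gam (nu - k)))).
  by rewrite ler_wpM2l// mulr_ge0 ?expR_ge0// invr_ge0 ltW.
rewrite le_eqVlt; apply/orP; left; apply/eqP.
have -> : expR (- nu * y) / gam nu * (expR (k * (2 * (y - ln 2))) * gam (nu - k)) =
  gam (nu - k) / gam nu * (expR (- nu * y) * expR (k * (2 * (y - ln 2)))) by ring.
rewrite -[RHS]mulrA -!expRD; congr (_ * expR _); ring.
Qed.

Lemma KC_bnd w k : `|w| < k -> bnd setT (- k) (KC w) /\ bnd setT (- k) (KC1 w).
Proof.
move=> wk; have [C C0 H] := KBlog_le wk (expbnd_coshw w).
by split; exists C => y _; rewrite mulNr; case: (H y).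
Qed.

Lemma bnd_sub (P Q : R -> Prop) r f : (forall y, Q y -> P y) -> bnd P r f -> bnd Q r f.
Proof. by move=> QP [C H]; exists C => y /QP; exact: H. Qed.

Lemma KC_derive w y : is_derive y 1 (KC w) (KC1 w y).
Proof. exact: KBlog_derive (expbnd_coshw w). Qed.

Lemma KC1_derive w y : is_derive y 1 (KC1 w) ((w ^+ 2 + expR y ^+ 2) * KC w y).
Proof.
apply: (dKBlog_derive (phi1 := fun u => w * sinh (w * u))).
- by move=> u; der; ring.
- by move=> u; der; ring.
- exact: expbnd_coshw.
- by apply: expbndZ; exact: expbnd_sinhw.
Qed.

(** This is minus one half of [4 (a + k) / (k! Gamma(1 - k - 2a))]. The half compensates for [KC]
    being twice the Macdonald function; the sign reappears in [remK]. *)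
Definition bcoef nu (k : nat) := (nu - 2 * k%:R) / (k`!%:R * gam (1 + nu - k%:R)).

(* In the variable y = ln x and with nu = - 2 a, this is
   x^{2a} (1 + (2/x)^{2a} sum_{k<m} 4(a+k) K_{2a+2k}(x) / (k! Gamma(1-k-2a))). *)
Definition remK nu (m : nat) y := expR (- nu * y) -
  expR (- (nu * ln 2)) * \sum_(0 <= k < m) bcoef nu k * KC (nu - 2 * k%:R) y.

Definition dremK nu (m : nat) y := - nu * expR (- nu * y) -
  expR (- (nu * ln 2)) * \sum_(0 <= k < m) bcoef nu k * KC1 (nu - 2 * k%:R) y.

Lemma dv_sum (n : nat) (F dF : nat -> R -> R) y :
  (forall k, is_derive y 1 (F k) (dF k y)) ->
  is_derive y 1 (fun y => \sum_(0 <= k < n) F k y) (\sum_(0 <= k < n) dF k y).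
Proof.
move=> H; elim: n => [|n IH].
  rewrite big_geq// (_ : (fun y => _) = (fun _ => 0)); first exact: dv_cst.
  by apply/funext => z; rewrite big_geq.
rewrite big_nat_recr//= (_ : (fun y => _) =
  (fun y => \sum_(0 <= k < n) F k y + F n y)); first exact: dvD.
by apply/funext => z; rewrite big_nat_recr.
Qed.

Lemma remK_derive nu m y : is_derive y 1 (remK nu m) (dremK nu m y).
Proof.
have D : is_derive y 1 (fun y => \sum_(0 <= k < m) bcoef nu k * KC (nu - 2 * k%:R) y)
    (\sum_(0 <= k < m) bcoef nu k * KC1 (nu - 2 * k%:R) y).
  apply: (@dv_sum m (fun k y => bcoef nu k * KC (nu - 2 * k%:R) y)
    (fun k y => bcoef nu k * KC1 (nu - 2 * k%:R) y)) => k.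
  have K := KC_derive (nu - 2 * k%:R) y.
  by der; ring.
by rewrite /remK /dremK; der; ring.
Qed.

Lemma natS1 (j : nat) : j.+1%:R = j%:R + 1 :> R.
Proof. by rewrite natr1. Qed.

(** The difference of squares equals [4 (j + 1) (nu - j - 1)]. Its factor [j + 1] lowers the
    factorial, and [nu - j - 1] lowers the argument of [gam] through [gamS]. *)
Lemma bcoefS nu j : j.+1%:R < nu ->
  bcoef nu j.+1 * (nu ^+ 2 - (nu - 2 * j.+1%:R) ^+ 2) = 4 * bcoef (nu - 2) j.
Proof.
move=> jn; rewrite /bcoef factS natrM (natS1 j).
have jn' : j%:R + 1 < nu by rewrite natr1.
have p0 : 0 < nu - j%:R - 1 by lra.
have g0 := gam_gt0 p0.
have -> : 1 + (nu - 2) - j%:R = nu - j%:R - 1 by lra.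
have -> : 1 + nu - (j%:R + 1) = (nu - j%:R - 1) + 1 by lra.
rewrite gamS//; have f0 : 0 < j`!%:R :> R by rewrite ltr0n fact_gt0.
have j0 : 0 <= j%:R :> R by [].
set J := j%:R in jn' p0 g0 j0 *; set g := gam _ in g0 *; set f := _%:R in f0 *.
by field; rewrite !gt_eqF//; lra.
Qed.

Lemma dremK_derive nu m y : (0 < m)%N -> 2 * m%:R - 2 < nu ->
  is_derive y 1 (dremK nu m)
    ((nu ^+ 2 + expR y ^+ 2) * remK nu m y - remK (nu - 2) m.-1 y).
Proof.
case: m => [|m _ mn]; first by move=> F; exfalso; move: F.
have mn' : 2 * m%:R < nu by move: mn; rewrite (natS1 m); lra.
have D : is_derive y 1 (fun y => \sum_(0 <= k < m.+1) bcoef nu k * KC1 (nu - 2 * k%:R) y)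
    (\sum_(0 <= k < m.+1) bcoef nu k *
      (((nu - 2 * k%:R) ^+ 2 + expR y ^+ 2) * KC (nu - 2 * k%:R) y)).
  apply: (@dv_sum m.+1 (fun k y => bcoef nu k * KC1 (nu - 2 * k%:R) y)
    (fun k y => bcoef nu k * (((nu - 2 * k%:R) ^+ 2 + expR y ^+ 2) * KC (nu - 2 * k%:R) y))) => k.
  have K := KC1_derive (nu - 2 * k%:R) y.
  by der; ring.
rewrite /dremK; der; rewrite /remK /=.
set S1 := \sum_(0 <= k < m.+1) _ * (_ * _); set S2 := \sum_(0 <= k < m.+1) bcoef nu k * KC (nu - 2 * k%:R) y.
set S3 := \sum_(0 <= k < m) _ * _; set S0 := \sum_(0 <= k < m.+1) bcoef nu k * KC1 _ y.
(* Each term solves the equation of its own order [nu - 2 k], so only differences of squared orders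
   remain. The one for [k = 0] is 0, and [bcoefS] turns the others into the sum for [nu - 2], with
   the index lowered by one. *)
have E : (nu ^+ 2 + expR y ^+ 2) * S2 - S1 = 4 * S3.
  rewrite /S1 /S2 /S3 !mulr_sumr -sumrB big_nat_recl//=.
  rewrite [X in X + _](_ : _ = 0); last by rewrite mulr0 subr0; ring.
  rewrite add0r; apply: eq_big_nat => k /andP[_ km].
  have kn : k.+1%:R < nu.
    apply: le_lt_trans mn'; have : k.+1%:R <= m%:R :> R by rewrite ler_nat.
    by have : 0 <= m%:R :> R by []; lra.
  have -> : nu - 2 - 2 * k%:R = nu - 2 * k.+1%:R by rewrite (natS1 k); lra.
  by rewrite [RHS]mulrA -(bcoefS kn); ring.
have e2 : expR (- (nu - 2) * y) = expR (- nu * y) * expR y ^+ 2.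
  by rewrite -expRM_natl -expRD; congr expR; ring.
(* The factor 4 from [bcoefS] is the ratio of the prefactors [2^{-(nu-2)}] and [2^{-nu}]. *)
have e4 : expR (- ((nu - 2) * ln 2)) = 4 * expR (- (nu * ln 2)) :> R.
  have -> : 4 = expR (2%:R * ln 2) :> R.
    by rewrite expRM_natl lnK ?posrE//; ring.
  by rewrite -expRD; congr expR; ring.
rewrite e2 e4.
have -> : S1 = (nu ^+ 2 + expR y ^+ 2) * S2 - 4 * S3 by rewrite -E; ring.
by ring.
Qed.

(** The decay at -oo makes the integrals against [T_s] converge. At +oo the rate 2 covers
    [expR (- nu * y)] for every [nu > -2], and [T_s] outweighs it. *)
Definition tame (f f1 : R -> R) := exists2 d : R, 0 < d &
  [/\ bnd nonpos d f, bnd nonpos d f1, bnd nonneg 2 f & bnd nonneg 2 f1].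

Lemma remK_bnd_nonneg nu m : - 2 < nu ->
  bnd nonneg 2 (remK nu m) /\ bnd nonneg 2 (dremK nu m).
Proof.
move=> n2.
have K w : bnd nonneg 2 (KC w) /\ bnd nonneg 2 (KC1 w).
  have [|A B] := @KC_bnd w (`|w| + 1); first by rewrite ltrDl.
  have w2 : - (`|w| + 1) <= 2 by have := normr_ge0 w; lra.
  split; apply: (bnd_leP w2); [exact: bnd_sub A|exact: bnd_sub B].
have E : bnd nonneg 2 (fun y => expR (- nu * y)).
  by apply: (@bnd_leP _ (- nu)); [lra|exact: bnd_expR].
split; rewrite /remK /dremK; apply: bndD.
- exact: E.
- apply: bndN; apply: bndZ; apply: (@bnd_sum _ _ _ _ _ (fun k y => bcoef nu k * KC (nu - 2 * k%:R) y)) => k _.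
  by apply: bndZ; case: (K (nu - 2 * k%:R)).
- by apply: bndZ.
- apply: bndN; apply: bndZ; apply: (@bnd_sum _ _ _ _ _ (fun k y => bcoef nu k * KC1 (nu - 2 * k%:R) y)) => k _.
  by apply: bndZ; case: (K (nu - 2 * k%:R)).
Qed.

Lemma remK_bnd_small nu m : 2 * m%:R < nu -> exists2 g : R, 0 < g &
  bnd nonpos (g - nu) (remK nu m.+1).
Proof.
move=> mn; have m0 : 0 <= m%:R :> R by [].
have n0 : 0 < nu by lra.
have [g g0 H] := KC_leading n0.
exists (Num.min g 1); first by rewrite lt_min g0 ltr01.
(* As [gam (1 + nu) = nu * gam nu], the coefficient for [k = 0] is exactly the one that cancels the
   leading term in [KC_leading]. *)
have c0 : expR (- (nu * ln 2)) * bcoef nu 0 = (expR (nu * ln 2) * gam nu)^-1.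
  rewrite /bcoef fact0 mul1r mulr0 !subr0 addrC gamS// expRN.
  have := gam_gt0 n0; have := expR_gt0 (nu * ln 2 : R) => e0 g1.
  by field; rewrite !gt_eqF.
apply: (@bnd_eq _ _ _ (fun y => (expR (- nu * y) - (expR (nu * ln 2) * gam nu)^-1 * KC nu y)
   - expR (- (nu * ln 2)) * \sum_(1 <= k < m.+1) bcoef nu k * KC (nu - 2 * k%:R) y)).
  move=> y _; rewrite /remK [in RHS]big_ltn// -c0 mulr0 subr0; ring.
apply: bndD.
  by apply: bnd_leN H; rewrite lerD2r ge_min lexx.
apply: bndN; apply: bndZ; apply: (@bnd_sum _ _ _ _ _ (fun k y => bcoef nu k * KC (nu - 2 * k%:R) y)) => k.
move=> /andP[k1 km]; apply: bndZ; apply: (@bnd_leN _ (- (nu - 1))).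
  by rewrite opprB lerD2r ge_min lexx orbT.
have k1' : 1 <= k%:R :> R by rewrite ler1n.
have km' : k%:R <= m%:R :> R by rewrite ler_nat.
(* For [1 <= k <= m] the order lies between 0 and [nu - 2], so these terms are less singular than
   [expR (- nu * y)] and may be estimated one by one. *)
have [|A _] := @KC_bnd (nu - 2 * k%:R) (nu - 1); last exact: bnd_sub A.
by rewrite ger0_norm; lra.
Qed.

Lemma wronskian_derive (f f1 k k1 : R -> R) (A g : R) y :
  is_derive y 1 f (f1 y) -> is_derive y 1 f1 (A * f y - g) ->
  is_derive y 1 k (k1 y) -> is_derive y 1 k1 (A * k y) ->
  is_derive y 1 (fun y => f1 y * k y - f y * k1 y) (- (g * k y)).
Proof.
move=> h1 h2 h3 h4; apply: (dv_eq (dvD (dvM h2 h3) (dvN (dvM h1 h4)))); ring.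
Qed.

(* Variation of constants: the Wronskian of (f, k) has derivative - g k, and
   (f / k)' is this Wronskian over k^2. As f / k vanishes at -oo, two
   integrations transfer the decay of g to f. *)
Lemma variation_of_constants (f f1 g k k1 A : R -> R) (nu d e c : R) :
  0 < d -> d < nu -> 0 < e -> 0 < c ->
  (forall y, is_derive y 1 f (f1 y)) ->
  (forall y, is_derive y 1 f1 (A y * f y - g y)) ->
  (forall y, is_derive y 1 k (k1 y)) ->
  (forall y, is_derive y 1 k1 (A y * k y)) ->
  (forall y, 0 < k y) -> (forall y, y <= 0 -> c * expR (- nu * y) <= k y) ->
  bnd nonpos (- nu) k -> bnd nonpos (- nu) k1 ->
  bnd nonpos d g -> bnd nonpos (e - nu) f ->
  bnd nonpos d f /\ bnd nonpos d f1.
Proof.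
move=> d0 dn e0 c0 df df1 dk dk1 kp klow kup k1up H G.
have kinv := bnd_inv c0 klow; rewrite opprK in kinv.
have dW y := wronskian_derive (df y) (df1 y) (dk y) (dk1 y).
(* As [d < nu], the derivative [- (g k)] of the Wronskian may grow towards -oo, and the integration
   starts from 0. *)
have WB : bnd nonpos (d - nu) (fun y => f1 y * k y - f y * k1 y).
  rewrite -[d - nu]opprK opprB; apply: bnd_primitiveN dW _; first by lra.
  by rewrite opprB; apply: bndN; exact: bndM.
have dq y : is_derive y 1 (fun y => f y * (k y)^-1)
    ((f1 y * k y - f y * k1 y) * ((k y)^-1 * (k y)^-1)).
  apply: (dv_eq (dvM (df y) (dvV (lt0r_neq0 (kp y)) (dk y)))).
  by have h0 := kp y; field; rewrite gt_eqF.
(* The weak rate [e - nu] of [f] enters here: it forces [f / k] to vanish at -oo, that is, it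
   excludes a multiple of [k] from [f]. *)
have fB : bnd nonpos (d + nu) (fun y => f y * (k y)^-1).
  apply: (bnd_primitiveP _ e0 dq); first by lra.
    by rewrite [X in bnd _ X](_ : e = (e - nu) + nu); [exact: bndM|lra].
  rewrite [X in bnd _ X](_ : d + nu = (d - nu) + (nu + nu)); last by lra.
  by apply: bndM => //; exact: bndM.
have DB : bnd nonpos d f.
  apply: (@bnd_eq _ _ _ (fun y => (f y * (k y)^-1) * k y)).
    by move=> y _; rewrite divfK// gt_eqF.
  by rewrite [X in bnd _ X](_ : d = (d + nu) + - nu); [exact: bndM|lra].
split => //.
apply: (@bnd_eq _ _ _ (fun y => ((f1 y * k y - f y * k1 y) + f y * k1 y) * (k y)^-1)).
  by move=> y _; rewrite subrK mulfK// gt_eqF.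
rewrite [X in bnd _ X](_ : d = (d + - nu) + nu); last by lra.
by apply: bndM => //; apply: bndD => //; exact: bndM.
Qed.

Lemma remK_tame m : forall nu, 2 * m%:R - 2 < nu < 2 * m%:R -> tame (remK nu m) (dremK nu m).
Proof.
elim: m => [nu /andP[n1 n2]|m IH nu /andP[n1 n2]].
  exists (- nu); first by lra.
  have [A B] : bnd nonneg 2 (remK nu 0) /\ bnd nonneg 2 (dremK nu 0).
    by apply: remK_bnd_nonneg; lra.
  split => //.
    apply: (@bnd_eq _ _ _ (fun y => expR (- nu * y))); last exact: bnd_expR.
    by move=> y _; rewrite /remK big_geq// mulr0 subr0.
  apply: (@bnd_eq _ _ _ (fun y => - nu * expR (- nu * y))).
    by move=> y _; rewrite /dremK big_geq// mulr0 subr0.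
  by apply: bndZ; exact: bnd_expR.
have m0 : 0 <= m%:R :> R by [].
have mn : 2 * m%:R < nu by move: n1; rewrite (natS1 m); lra.
have n0 : 0 < nu by lra.
have [A B] : bnd nonneg 2 (remK nu m.+1) /\ bnd nonneg 2 (dremK nu m.+1).
  by apply: remK_bnd_nonneg; lra.
have [d0 d00 [H _ _ _]] : tame (remK (nu - 2) m) (dremK (nu - 2) m).
  by apply: IH; apply/andP; split; move: n2; rewrite (natS1 m); lra.
(* The cap [nu / 2] secures the rate below [nu] that [variation_of_constants] asks for. *)
pose d := Num.min d0 (nu / 2).
have dp : 0 < d by rewrite lt_min d00 divr_gt0.
have dn : d < nu by rewrite (@le_lt_trans _ _ (nu / 2))//; [rewrite /d ge_min lexx orbT|lra].
have {}H : bnd nonpos d (remK (nu - 2) m) by apply: bnd_leN H; rewrite ge_min lexx.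
have [c c0 klow] := KC_lower n0.
have [g g0 G] := remK_bnd_small mn.
have [|DB D1B] := @variation_of_constants (remK nu m.+1) (dremK nu m.+1) (remK (nu - 2) m)
    (KC nu) (KC1 nu) (fun y => nu ^+ 2 + expR y ^+ 2) nu d g c dp dn g0 c0
    (remK_derive nu m.+1) _ (KC_derive nu) (KC1_derive nu)
    (fun y => KC_gt0 y n0) klow (KC_upper n0) (KC1_upper n0) H G.
  by move=> y; apply: (@dremK_derive nu m.+1) => //; lra.
by exists d.
Qed.

End MacdonaldNearZero.

(** * The Mellin-type recurrence *)

Section Mellin.
Context {R : realType}.
Notation mu := (@lebesgue_measure R).
Implicit Types (f g : R -> R) (s u y : R).

Notation nonpos := (fun y : R => y <= 0).
Notation nonneg := (fun y : R => 0 <= y).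
Notation Tc s := (@KBlog R (fun u : R => cos (2 * s * u))).
Notation Tc1 s := (@dKBlog R (fun u : R => cos (2 * s * u))).

Lemma bnd_two_sided f r r' : 0 < r -> 0 < r' -> bnd nonpos r f -> bnd nonneg (- r') f ->
  exists2 k, 0 < k & exists2 C, 0 <= C & forall y, `|f y| <= C * expR (- (k * `|y|)).
Proof.
move=> r0 r0' H H'; exists (Num.min r r'); first by rewrite lt_min r0.
have {}H : bnd nonpos (Num.min r r') f by apply: bnd_leN H; rewrite ge_min lexx.
have {}H' : bnd nonneg (- Num.min r r') f.
  by apply: bnd_leP H'; rewrite lerN2 ge_min lexx orbT.
have [C C0 HC] := bnd_abs H; have [C' C0' HC'] := bnd_abs H'.
exists (C + C'); first exact: addr_ge0.
move=> y; rewrite mulrDl; case: (lerP 0 y) => y0.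
  rewrite (ger0_norm y0) (le_trans (HC' y y0))// mulNr lerDr.
  by rewrite mulr_ge0 ?expR_ge0.
rewrite (ltr0_norm y0) mulrN opprK (le_trans (HC y (ltW y0)))// lerDl.
by rewrite mulr_ge0 ?expR_ge0.
Qed.

Lemma Tc_bnd s k : 0 < k -> bnd setT (- k) (Tc s) /\ bnd setT (- k) (Tc1 s).
Proof.
move=> k0; have [C C0 H] := KBlog_le k0 (expbnd_cos (2 * s)).
by split; exists C => y _; rewrite mulNr; case: (H y).
Qed.

(** At -oo [T_s] grows more slowly than any exponential, so half of the rate [d] survives. At +oo
    its decay at rate 3 exceeds the growth of [f] by one. *)
Lemma tame_Tc f d s : 0 < d -> bnd nonpos d f -> bnd nonneg 2 f ->
  (exists2 k, 0 < k & exists2 C, 0 <= C & forall y, `|f y * Tc s y| <= C * expR (- (k * `|y|))) /\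
  (exists2 k, 0 < k & exists2 C, 0 <= C & forall y, `|f y * Tc1 s y| <= C * expR (- (k * `|y|))).
Proof.
move=> d0 H H'; have d2 : 0 < d / 2 by rewrite divr_gt0.
have [A A1] := Tc_bnd s d2.
have [B B1] : bnd setT (- 3) (Tc s) /\ bnd setT (- 3) (Tc1 s) by exact: Tc_bnd.
split; apply: (@bnd_two_sided _ (d / 2) 1) => //.
- rewrite [X in bnd _ X](_ : d / 2 = d + - (d / 2)); last by lra.
  by apply: bndM => //; exact: bnd_sub A.
- rewrite [X in bnd _ X](_ : - 1 = 2 + - 3 :> R); last by lra.
  by apply: bndM => //; exact: bnd_sub B.
- rewrite [X in bnd _ X](_ : d / 2 = d + - (d / 2)); last by lra.
  by apply: bndM => //; exact: bnd_sub A1.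
- rewrite [X in bnd _ X](_ : - 1 = 2 + - 3 :> R); last by lra.
  by apply: bndM => //; exact: bnd_sub B1.
Qed.

Lemma intg_Tc f d s : continuous f -> 0 < d -> bnd nonpos d f -> bnd nonneg 2 f ->
  intg (fun y => f y * Tc s y).
Proof.
move=> cf d0 H H'; have [[k k0 [C C0 HC]] _] := tame_Tc s d0 H H'.
apply: (intg_expabs_le k0) HC; apply: ctsM => //; exact: KBlog_cts (expbnd_cos _).
Qed.

Lemma mellin_step f f1 g nu d s : 0 < d ->
  (forall y : R, is_derive y 1 f (f1 y)) ->
  (forall y : R, is_derive y 1 f1 ((nu ^+ 2 + expR y ^+ 2) * f y - g y)) ->
  continuous g -> tame f f1 -> bnd nonpos d g -> bnd nonneg 2 g ->
  (nu ^+ 2 + 4 * s ^+ 2) * \int[mu]_y (f y * Tc s y) = \int[mu]_y (g y * Tc s y).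
Proof.
move=> d0 df df1 cg [e e0 [F1 F2 F3 F4]] G1 G2.
have cf := dv_cts df; have cf1 := dv_cts df1.
have dT y : is_derive y (1 : R) (Tc s) (Tc1 s y) by exact: KBlog_derive (expbnd_cos _).
have dT1 y : is_derive y (1 : R) (Tc1 s) ((- (4 * s ^+ 2) + expR y ^+ 2) * Tc s y).
  apply: (dKBlog_derive (phi1 := fun u => - (2 * s) * sin (2 * s * u))).
  - by move=> u; der; ring.
  - by move=> u; der; ring.
  - exact: expbnd_cos.
  - by apply: expbndZ; exact: expbnd_sin.
pose L := nu ^+ 2 + 4 * s ^+ 2.
(* The equation of [f] is given the coefficient of that of [T_s]. The discrepancy
   [L = nu^2 + 4 s^2], which is [4 (a^2 + s^2)], moves into the source, so [wronskian_derive]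
   applies. *)
have E y : (nu ^+ 2 + expR y ^+ 2) * f y - g y =
  (- (4 * s ^+ 2) + expR y ^+ 2) * f y - (g y - L * f y) by rewrite /L; ring.
have dW y : is_derive y (1 : R) (fun y => f1 y * Tc s y - f y * Tc1 s y)
    (L * (f y * Tc s y) - g y * Tc s y).
  apply: (dv_eq (wronskian_derive (df y) (dv_eq (df1 y) (E y)) (dT y) (dT1 y))).
  by ring.
have jf := intg_Tc s cf e0 F1 F3; have jg := intg_Tc s cg d0 G1 G2.
have [[k k0 [C C0 HC]] _] := tame_Tc s e0 F2 F4.
have [_ [k' k0' [C' C0' HC']]] := tame_Tc s e0 F1 F3.
have [Ay An] := cvg_expabs k0 HC; have [By Bn] := cvg_expabs k0' HC'.
have cT : continuous (Tc s) by exact: dv_cts dT.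
have Z : \int[mu]_y (L * (f y * Tc s y) - g y * Tc s y) = (0 - 0) - (0 - 0).
  apply: (Rint_FTC dW).
  - by apply: ctsD; [apply: ctsM; [exact: cts_cst|exact: ctsM]|apply: ctsN; exact: ctsM].
  - by apply: intgB => //; exact: intgZ.
  - by apply: cvgB; [exact: Ay|exact: By].
  - by apply: cvgB; [exact: An|exact: Bn].
move: Z; rewrite RintB ?RintZ//; last exact: intgZ.
by rewrite !subrr => /eqP; rewrite subr_eq0 => /eqP.
Qed.

Lemma kernel_dom f d : 0 < d -> bnd nonpos d f -> bnd nonneg 2 f ->
  exists2 k, 0 < k & exists2 C, 0 <= C & forall y u,
  `|f y * expR (- (expR y * cosh u))| <= C * expR (- (k * `|y|)) * expR (- (k * `|u|)).
Proof.
move=> d0 /bnd_abs[A A0 HA] /bnd_abs[B B0 HB].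
(* For [y < 0] the rate that remains is [d - k], at least [k]; for [y >= 0] it is [3 - 2 = 1]. *)
pose k := Num.min (d / 2) 1.
have k0 : 0 < k by rewrite lt_min divr_gt0 ?ltr01.
have kd : k <= d / 2 by rewrite ge_min lexx.
have k1 : k <= 1 by rewrite ge_min lexx orbT.
have [C C0 HC] := bessel_weight 0 k0.
have [E E0 HE] := @bessel_weight R 0 3 (ltr0n R 3).
exists k => //; exists (A * C + B * E); first by rewrite addr_ge0// mulr_ge0// ltW.
move=> y u; rewrite normrM (ger0_norm (expR_ge0 _)) 2!mulrDl.
have P : 0 <= A * C * expR (- (k * `|y|)) * expR (- (k * `|u|)).
  by rewrite !mulr_ge0 ?expR_ge0// ltW.
have Q : 0 <= B * E * expR (- (k * `|y|)) * expR (- (k * `|u|)).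
  by rewrite !mulr_ge0 ?expR_ge0// ltW.
case: (lerP 0 y) => y0.
  have h := HE y u; rewrite expr0 mul1r in h.
  apply: (@le_trans _ _ (B * expR (2 * y) * (E * expR (- (3 * y)) * expR (- (3 * `|u|))))).
    by apply: ler_pM; rewrite ?normr_ge0 ?expR_ge0 ?HB.
  apply: (@le_trans _ _ (B * E * expR (- (k * `|y|)) * expR (- (k * `|u|)))); last by rewrite lerDr.
  have -> : B * expR (2 * y) * (E * expR (- (3 * y)) * expR (- (3 * `|u|))) =
     B * E * expR (- y) * expR (- (3 * `|u|)).
    have -> : - y = 2 * y + - (3 * y) by lra.
    by rewrite expRD; ring.
  have BE : 0 <= B * E by rewrite mulr_ge0// ltW.
  apply: ler_pM; rewrite ?expR_ge0//.
  - by rewrite mulr_ge0 ?expR_ge0.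
  - apply: ler_wpM2l => //; rewrite ler_expR lerN2 ger0_norm//.
    by rewrite -[leRHS]mul1r ler_wpM2r.
  - rewrite ler_expR lerN2; apply: ler_wpM2r; [exact: normr_ge0|lra].
have h := HC y u; rewrite expr0 mul1r in h.
apply: (@le_trans _ _ (A * expR (d * y) * (C * expR (- (k * y)) * expR (- (k * `|u|))))).
  by apply: ler_pM; rewrite ?normr_ge0 ?expR_ge0 ?HA// ltW.
apply: (@le_trans _ _ (A * C * expR (- (k * `|y|)) * expR (- (k * `|u|)))); last by rewrite lerDl.
have -> : A * expR (d * y) * (C * expR (- (k * y)) * expR (- (k * `|u|))) =
     A * C * expR ((d - k) * y) * expR (- (k * `|u|)).
  have -> : (d - k) * y = d * y + - (k * y) by ring.
  by rewrite expRD; ring.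
rewrite ler_wpM2r ?expR_ge0//; apply: ler_wpM2l; first by rewrite mulr_ge0// ltW.
rewrite ler_expR ltr0_norm// mulrN opprK; apply: ler_wnM2r; first exact: ltW.
lra.
Qed.

(** With [x = expR y] and [f = remK nu n.+1] this is the integral on the right-hand side of the
    theorem, without its constant. *)
Definition cosh_laplace f (xi : R) : R := \int[mu]_y (f y * expR (- (expR y * cosh (xi / 2)))).

Section Kernel.
Variables (f : R -> R) (d : R).
Hypotheses (cf : continuous f) (d0 : 0 < d).
Hypotheses (H : bnd nonpos d f) (H' : bnd nonneg 2 f).

Lemma cosh_laplace_int (xi : R) : intg (fun y => f y * expR (- (expR y * cosh (xi / 2)))).
Proof.
have [k k0 [C C0 HC]] := kernel_dom d0 H H'.
apply: (@intg_expabs_le R _ (C * expR (- (k * `|xi / 2|))) k) => //; first by cts.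
by move=> y; rewrite mulrAC; exact: HC.
Qed.

Lemma cosh_laplace_cts : continuous (cosh_laplace f).
Proof.
have [k k0 [C C0 HC]] := kernel_dom d0 H H'.
move=> x; have := @continuity_under_integral R _ _ mu
  (fun xi y => f y * expR (- (expR y * cosh (xi / 2)))) setT measurableT (x - 1) (x + 1).
move=> /(_ _ _ (fun y => C * expR (- (k * `|y|)))); apply.
- by move=> z _; exact: cosh_laplace_int.
- apply/aeW => y _ z _.
  have : continuous (fun xi : R => f y * expR (- (expR y * cosh (xi / 2)))) by cts.
  exact.
- by apply: intgZ; exact: intg_expabs.
- move=> z _; apply/aeW => y _; apply: le_trans (HC _ _) _.
  rewrite ler_piMr ?mulr_ge0 ?expR_ge0// expR_le1 oppr_le0 mulr_ge0 ?normr_ge0//.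
  exact: ltW.
- by rewrite inE/= in_itv/=; apply/andP; split; lra.
Qed.

Lemma cosh_laplace_bound : exists2 k, 0 < k & exists2 C, 0 <= C &
  forall xi, `|cosh_laplace f xi| <= C * expR (- (k * `|xi|)).
Proof.
have [k k0 [C C0 HC]] := kernel_dom d0 H H'.
pose J := \int[mu]_y expR (- (k * `|y|)).
have J0 : 0 <= J by apply: Rintegral_ge0 => y _; exact: expR_ge0.
exists (k / 2); first by rewrite divr_gt0.
exists (C * J); first exact: mulr_ge0.
move=> xi; pose c := C * expR (- (k / 2 * `|xi|)).
have -> : C * J * expR (- (k / 2 * `|xi|)) = \int[mu]_y (c * expR (- (k * `|y|))).
  by rewrite RintZ; [rewrite mulrAC|exact: intg_expabs].
apply: Rint_norm_le.
- by apply: continuous_measurable_fun; cts.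
- by apply: intgZ; exact: intg_expabs.
move=> y; apply: le_trans (HC _ _) _; rewrite mulrAC /c.
suff -> : k * `|xi / 2| = k / 2 * `|xi| by [].
by rewrite normrM (@ger0_norm _ 2^-1) ?invr_ge0//; field.
Qed.

Lemma cosh_laplace_integrable : intg (cosh_laplace f).
Proof.
have [k k0 [C C0 HC]] := cosh_laplace_bound.
by apply: (intg_expabs_le k0) HC; exact: cosh_laplace_cts.
Qed.

Lemma mes_fst (h : R -> R) : continuous h -> measurable_fun setT (fun p : R * R => h p.1).
Proof.
move=> ch; apply: (@measurableT_comp _ _ _ _ _ _ h _ fst).
  exact: continuous_measurable_fun.
exact: measurable_fst.
Qed.

Lemma mes_snd (h : R -> R) : continuous h -> measurable_fun setT (fun p : R * R => h p.2).
Proof.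
move=> ch; apply: (@measurableT_comp _ _ _ _ _ _ h _ snd).
  exact: continuous_measurable_fun.
exact: measurable_snd.
Qed.

Lemma mes_expRN (h : R * R -> R) : measurable_fun setT h ->
  measurable_fun setT (fun p => expR (- h p)).
Proof.
have me : measurable_fun setT (fun x : R => expR (- x)).
  by apply: continuous_measurable_fun; cts.
by move=> mh; exact: (measurableT_comp me mh).
Qed.

(** After the interchange of integrals, [u = xi / 2] turns [cos (s * xi)] into [cos (2 * s * u)] and
    produces the factor 2; the inner integral is then [T_s]. *)
Lemma cosh_laplace_fourier s : \int[mu]_xi (cosh_laplace f xi * cos (s * xi)) =
  2 * \int[mu]_y (f y * Tc s y).
Proof.
have [k k0 [C C0 HC]] := kernel_dom d0 H H'.
have HC2 (xi y : R) : `|f y * expR (- (expR y * cosh (xi / 2))) * cos (s * xi)| <=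
    expR (- (k / 2 * `|xi|)) * (C * expR (- (k * `|y|))).
  rewrite normrM -[leRHS]mulr1; apply: ler_pM => //; last exact: cos_max.
  apply: le_trans (HC _ _) _; rewrite mulrC.
  suff -> : k * `|xi / 2| = k / 2 * `|xi| by [].
  by rewrite normrM (@ger0_norm _ 2^-1) ?invr_ge0//; field.
transitivity (\int[mu]_xi \int[mu]_y
   (f y * expR (- (expR y * cosh (xi / 2))) * cos (s * xi))).
  apply: eq_Rintegral => xi _; rewrite /cosh_laplace mulrC -RintZ; last exact: cosh_laplace_int.
  by apply: eq_Rintegral => y _; rewrite mulrC.
rewrite (@Rfubini R (fun p => f p.2 * expR (- (expR p.2 * cosh (p.1 / 2))) * cos (s * p.1))
  (fun xi => expR (- (k / 2 * `|xi|))) (fun y => C * expR (- (k * `|y|)))) //.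
- rewrite -RintZ; last exact: intg_Tc d0 H H'.
  apply: eq_Rintegral => y _ /=.
  pose h (u : R) := expR (- (expR y * cosh u)) * cos (2 * s * u).
  have ch : continuous h by rewrite /h; cts.
  have jh : intg h by exact: KB_intg (expR_gt0 y) (expbnd_cos _).
  have h2 : 0 < 2^-1 :> R by rewrite invr_gt0.
  have [j1 I1] := @Rint_affine R 2^-1 0 h h2 ch jh.
  have E (xi : R) : f y * expR (- (expR y * cosh (xi / 2))) * cos (s * xi) =
     f y * h (2^-1 * xi + 0).
    by rewrite /h addr0 [2^-1 * xi]mulrC -mulrA; congr (_ * (_ * cos _)); field.
  transitivity (\int[mu]_xi (f y * h (2^-1 * xi + 0))).
    by apply: eq_Rintegral => xi _; exact: E.
  by rewrite RintZ// I1 invrK mulrCA.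
- apply: measurable_funM; last by apply: (@mes_fst (fun x => cos (s * x))); cts.
  apply: measurable_funM; first exact: mes_snd.
  apply: mes_expRN; apply: measurable_funM.
    by apply: (@mes_snd expR); cts.
  by apply: (@mes_fst (fun x => cosh (x / 2))); cts.
- by apply: intg_expabs; rewrite divr_gt0.
- by apply: intgZ; exact: intg_expabs.
Qed.

Lemma cosh_laplace_even xi : cosh_laplace f (- xi) = cosh_laplace f xi.
Proof. by rewrite /cosh_laplace mulNr coshN. Qed.

End Kernel.

End Mellin.

(** * Inversion of a nonnegative cosine transform *)

Section FourierInversion.
Context {R : realType}.
Notation mu := (@lebesgue_measure R).

Lemma abel_kernel (e v : R) : 0 < e ->
  \int[mu]_s (expR (- (e * `|s|)) * cos (v * s)) = 2 * e / (e ^+ 2 + v ^+ 2).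
Proof.
move=> e0; pose q := e ^+ 2 + v ^+ 2.
have q0 : 0 < q by rewrite ltr_pwDl ?exprn_gt0 ?sqr_ge0.
pose g (s : R) := expR (- (e * `|s|)) * cos (v * s).
have cg : continuous g by rewrite /g; cts.
have jg : intg g.
  apply: (@intg_expabs_le R _ 1 e) => // s.
  by rewrite normrM mul1r ger0_norm ?expR_ge0// ler_piMr ?expR_ge0// cos_max.
have [jS IS] : mu.-integrable `]0%R, +oo[ (EFin \o g) /\
    \int[mu]_(x in `]0, +oo[) g x = 2^-1 * \int[mu]_x g x.
  by apply: Rint_even => // s; rewrite /g normrN mulrN cosN.
rewrite -/g; suff : \int[mu]_(x in `]0, +oo[) g x = e / q.
  by rewrite IS => E; rewrite -[LHS](mulKf (x := 2^-1))// E invrK mulrA.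
pose f (s : R) := expR (- (e * s)) * cos (v * s).
(* [F] is the real part of [exp ((- e + i v) s) / (- e + i v)], hence a primitive of [f]. *)
pose G (s : R) := q^-1 * (v * sin (v * s) - e * cos (v * s)).
pose F (s : R) := expR (- (e * s)) * G s.
have fg (s : R) : s \in `]0, +oo[%classic -> g s = f s.
  by rewrite inE/= in_itv/= andbT /g /f => s0; rewrite gtr0_norm.
transitivity (\int[mu]_(x in `]0, +oo[) f x).
  by apply: eq_Rintegral => s; exact: fg.
have dF s : is_derive s (1 : R) F (f s).
  rewrite /F /G; der; rewrite /f /q; move: q0; rewrite /q => q0.
  by field; rewrite gt_eqF.
have Gb s : `|G s| <= q^-1 * (`|v| + e).
  rewrite normrM ger0_norm ?invr_ge0 ?(ltW q0)//; apply: ler_wpM2l.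
    by rewrite invr_ge0 ltW.
  rewrite (le_trans (ler_normB _ _))// lerD// normrM ?(ger0_norm (ltW e0)).
    by rewrite ler_piMr ?normr_ge0// sin_max.
  by apply: ler_piMr; [exact: ltW|exact: cos_max].
have [Fy _] : expR (- (e * `|s|)) * G s @[s --> +oo] --> 0 /\
    expR (- (e * `|s|)) * G s @[s --> -oo] --> 0.
  apply: (@cvg_expabs R _ (q^-1 * (`|v| + e)) e) => // s.
  by rewrite normrM ger0_norm ?expR_ge0// mulrC ler_wpM2r ?expR_ge0.
have F0 : F 0 = - (e / q).
  by rewrite /F /G !mulr0 oppr0 expR0 sin0 cos0; ring.
have n1 n : (n.+1%:R^-1 : R) <= 1 by rewrite invf_le1 ?ltr0n// ler1n.
(* The upper endpoint is [n + 2] because at [n = 0] the lower one is already 1. *)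
rewrite (@FTC_seq R F f _ (fun n => n.+1%:R^-1) (fun n => n.+2%:R) 0 (F 0)) //.
- by rewrite F0 opprK add0r.
- by rewrite /f; cts.
- move: jS; apply: eq_integrable => // s s0 /=; by rewrite fg.
- by move=> n; apply: le_lt_trans (n1 n) _; rewrite ltr1n.
- move=> n s; rewrite /= !in_itv/= andbT => /andP[h _].
  by apply: lt_le_trans h; rewrite invr_gt0 ltr0n.
- move=> s; rewrite /= in_itv/= andbT => s0; near=> n.
  rewrite /= in_itv/=; apply/andP; split.
    rewrite -[leRHS]invrK lef_pV2 ?posrE ?ltr0n ?invr_gt0//.
    by rewrite (@le_trans _ _ n%:R) ?ler_nat//; near: n; exact: nbhs_infty_ger.
  rewrite (@le_trans _ _ n%:R) ?ler_nat//; first by near: n; exact: nbhs_infty_ger.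
  by rewrite leqW.
- rewrite (_ : (fun n => F _) = (fun n : nat => expR (- (e * `|n.+2%:R|)) * G n.+2%:R)).
    apply: (@cvg_comp _ _ _ (fun n : nat => n.+2%:R) (fun s => expR (- (e * `|s|)) * G s)); last exact: Fy.
    apply/cvgryPge => A; near=> n.
    rewrite (@le_trans _ _ n%:R)//; first by near: n; exact: nbhs_infty_ger.
    by rewrite ler_nat leqW.
  by apply/funext => n; rewrite /F ger0_norm.
- apply: (@cvg_comp _ _ _ (fun n : nat => n.+1%:R^-1) F); first exact: cvg_harmonic.
  exact: (dv_cts dF).
Unshelve. all: by end_near. Qed.

Lemma cos_prod (a b : R) : cos a * cos b = 2^-1 * (cos (b - a) + cos (b + a)).
Proof. by rewrite cosB cosD; field. Qed.

Section Inversion.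
Variables (f : R -> R) (k C : R).
Hypotheses (cf : continuous f) (k0 : 0 < k).
Hypothesis fb : forall x, `|f x| <= C * expR (- (k * `|x|)).
Hypothesis ef : forall x, f (- x) = f x.

Let phi (s : R) : R := \int[mu]_x (f x * cos (s * x)).

Lemma f_integrable : intg f. Proof. exact: (intg_expabs_le k0 cf fb). Qed.

Lemma fcos_int s : intg (fun x => f x * cos (s * x)).
Proof.
apply: (@intg_le _ _ (fun x => `|f x|)); [by cts| |exact: intg_norm f_integrable].
by move=> x; rewrite normrM ler_piMr// cos_max.
Qed.

Lemma cos_transform_cts : continuous phi.
Proof.
move=> x; have := @continuity_under_integral R _ _ mu
  (fun s y => f y * cos (s * y)) setT measurableT (x - 1) (x + 1).
move=> /(_ _ _ (fun y => `|f y|)); apply.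
- by move=> z _; exact: fcos_int.
- apply/aeW => y _ z _.
  have : continuous (fun s : R => f y * cos (s * y)) by cts.
  exact.
- exact: intg_norm f_integrable.
- by move=> z _; apply/aeW => y _; rewrite normrM ler_piMr// cos_max.
- by rewrite inE/= in_itv/=; apply/andP; split; lra.
Qed.

Lemma cos_transform_bound s : `|phi s| <= \int[mu]_x `|f x|.
Proof.
apply: Rint_norm_le; [exact: intg_meas (fcos_int s)|exact: intg_norm f_integrable|].
by move=> x; rewrite normrM ler_piMr// cos_max.
Qed.

Lemma abel_intg e x : 0 < e ->
  intg (fun s => expR (- (e * `|s|)) * (phi s * cos (x * s))).
Proof.
move=> e0; apply: (@intg_expabs_le R _ (\int[mu]_x `|f x|) e) => //.
  by have cp := cos_transform_cts; cts.
move=> s; rewrite normrM ger0_norm ?expR_ge0// mulrC ler_wpM2r ?expR_ge0//.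
rewrite normrM; apply: le_trans (cos_transform_bound s).
by rewrite ler_piMr// cos_max.
Qed.

Lemma poisson_intg x e : intg (fun v => f (e * v + x) * (2 * (1 + v ^+ 2)^-1)).
Proof.
have [ji _] := @cauchy_int R.
apply: (@intg_le _ _ (fun v => C * 2 * (1 + v ^+ 2)^-1)); last exact: intgZ.
  by apply: ctsM; [apply: cts_comp => //; cts|apply: ctsM; [cts|exact: cts_cauchy]].
move=> v; rewrite normrM -mulrA; apply: ler_pM => //.
  apply: le_trans (fb _) _; rewrite ler_piMr//.
    by have := le_trans (normr_ge0 _) (fb 0); rewrite pmulr_lge0 ?expR_gt0.
  rewrite expR_le1 oppr_le0; apply: mulr_ge0; [exact: ltW|exact: normr_ge0].
rewrite ger0_norm//; apply: mulr_ge0 => //.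
by rewrite invr_ge0 ltW// cauchy_gt0.
Qed.

(** Fubini brings in [abel_kernel], the product of cosines yields Poisson kernels centred at [x] and
    [- x], and evenness of [f] identifies the two contributions. Rescaling by [e] leaves [e] only in
    the argument of [f]. *)
Lemma abel_poisson e x : 0 < e ->
  \int[mu]_s (expR (- (e * `|s|)) * (phi s * cos (x * s))) =
  \int[mu]_v (f (e * v + x) * (2 * (1 + v ^+ 2)^-1)).
Proof.
move=> e0.
transitivity (\int[mu]_s \int[mu]_u (expR (- (e * `|s|)) * cos (x * s) * (f u * cos (s * u)))).
  apply: eq_Rintegral => s _; rewrite RintZ; last exact: fcos_int.
  by rewrite -/(phi s); ring.
rewrite (@Rfubini R (fun p => expR (- (e * `|p.1|)) * cos (x * p.1) * (f p.2 * cos (p.1 * p.2)))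
   (fun s => expR (- (e * `|s|))) (fun u => `|f u|)) //; last 4 first.
- apply: measurable_funM.
    apply: measurable_funM; last by apply: (@mes_fst R (fun s => cos (x * s))); cts.
    by apply: (@mes_fst R (fun s => expR (- (e * `|s|)))); cts.
  apply: measurable_funM; first exact: mes_snd.
  have mc : measurable_fun setT (@cos R).
    by apply: continuous_measurable_fun; exact: continuous_cos.
  have mp : measurable_fun setT (fun p : R * R => p.1 * p.2).
    apply: measurable_funM.
      by apply: (@mes_fst R (fun s => s)); cts.
    by apply: (@mes_snd R (fun s => s)); cts.
  exact: (measurableT_comp mc mp).
- exact: intg_expabs.
- exact: intg_norm f_integrable.
- move=> s u /=; rewrite !normrM (ger0_norm (expR_ge0 _)); apply: ler_pM => //.
    by rewrite ler_piMr ?expR_ge0// cos_max.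
  by rewrite ler_piMr// cos_max.
pose P (v : R) := 2 * e / (e ^+ 2 + v ^+ 2).
have ecos_int w : intg (fun s => expR (- (e * `|s|)) * cos (w * s)).
  apply: (@intg_expabs_le R _ 1 e) => //; first by cts.
  by move=> s; rewrite normrM mul1r ger0_norm ?expR_ge0// ler_piMr ?expR_ge0// cos_max.
have P0 (v : R) : 0 < e ^+ 2 + v ^+ 2 by rewrite ltr_pwDl ?exprn_gt0 ?sqr_ge0.
have cP : continuous P.
  by apply: ctsM; [cts|apply: ctsV; [move=> v; rewrite gt_eqF|cts]].
have Pb v : `|P v| <= 2 / e.
  rewrite ger0_norm; last by rewrite divr_ge0 ?mulr_ge0// ltW.
  rewrite /P ler_pdivrMr// -subr_ge0.
  have -> : 2 / e * (e ^+ 2 + v ^+ 2) - 2 * e = 2 / e * v ^+ 2.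
    by field; rewrite gt_eqF.
  by rewrite mulr_ge0 ?sqr_ge0// divr_ge0// ltW.
have jfP y : intg (fun u => f u * P (u + y)).
  apply: (@intg_le _ _ (fun u => 2 / e * `|f u|)).
  - by apply: ctsM => //; apply: cts_comp => //; cts.
  - by move=> u; rewrite normrM mulrC ler_wpM2r.
  - by apply: intgZ; exact: intg_norm f_integrable.
have IP y : \int[mu]_u (f u * P (u + y)) = \int[mu]_v (f (e * v - y) * (2 * (1 + v ^+ 2)^-1)).
  have cF : continuous (fun u => f u * P (u + y)).
    by apply: ctsM => //; apply: cts_comp => //; cts.
  have [j I] := @Rint_affine R e (- y) _ e0 cF (jfP y).
  rewrite -[LHS](mulKf (x := e^-1)) ?invr_eq0 ?gt_eqF// -I -RintZ//.
  apply: eq_Rintegral => v _; rewrite invrK subrK mulrCA; congr (_ * _).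
  rewrite /P exprMn -[X in X + _]mulr1 -mulrDr.
  have c0 := cauchy_gt0 v.
  by field; rewrite !gt_eqF.
transitivity (\int[mu]_u (2^-1 * (f u * P (u + - x)) + 2^-1 * (f u * P (u + x)))).
  apply: eq_Rintegral => u _ /=.
  transitivity (\int[mu]_s (2^-1 * f u * (expR (- (e * `|s|)) * cos ((u - x) * s) +
      expR (- (e * `|s|)) * cos ((u + x) * s)))).
    apply: eq_Rintegral => s _.
    have -> : cos ((u - x) * s) = cos (s * u - x * s) by congr cos; ring.
    have -> : cos ((u + x) * s) = cos (s * u + x * s) by congr cos; ring.
    have := cos_prod (x * s) (s * u) => E.
    transitivity (expR (- (e * `|s|)) * f u * (cos (x * s) * cos (s * u))); first by ring.
    by rewrite E; ring.
  rewrite RintZ ?RintD//; last exact: intgD.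
  by rewrite !abel_kernel// /P; ring.
rewrite RintD; [|exact: intgZ|exact: intgZ].
rewrite !RintZ// !IP opprK.
have cH : continuous (fun v => f (e * v - x) * (2 * (1 + v ^+ 2)^-1)).
  by apply: ctsM; [apply: cts_comp => //; cts|apply: ctsM; [cts|exact: cts_cauchy]].
have jH : intg (fun v => f (e * v - x) * (2 * (1 + v ^+ 2)^-1)) by exact: poisson_intg.
have [_ <-] := Rint_opp cH jH.
have -> : \int[mu]_v (f (e * - v - x) * (2 * (1 + (- v) ^+ 2)^-1)) =
    \int[mu]_v (f (e * v + x) * (2 * (1 + v ^+ 2)^-1)).
  by apply: eq_Rintegral => v _; rewrite sqrrN mulrN -opprD ef.
by rewrite -mulrDl -[RHS]mul1r; congr (_ * _); field.
Qed.

Let en (n : nat) : R := n.+1%:R^-1.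
Let en0 n : 0 < en n. Proof. by rewrite invr_gt0 ltr0n. Qed.

(** By [abel_poisson] the damping parameter only moves the argument of the bounded function [f] to
    [x], so dominated convergence applies; [2 * pi] is the integral of [2 / (1 + v^2)]. *)
Lemma abel_lim x :
  \int[mu]_s (expR (- (en n * `|s|)) * (phi s * cos (x * s))) @[n --> \oo] --> 2 * pi * f x.
Proof.
have [ji Ii] := @cauchy_int R.
have -> : 2 * pi * f x = \int[mu]_v (f x * (2 * (1 + v ^+ 2)^-1)).
  rewrite RintZ; last exact: intgZ.
  by rewrite RintZ// Ii mulrC.
have fE : (fun n => \int[mu]_s (expR (- (en n * `|s|)) * (phi s * cos (x * s)))) =
   (fun n => \int[mu]_v (f (en n * v + x) * (2 * (1 + v ^+ 2)^-1))).
  by apply/funext => n; exact: abel_poisson.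
rewrite fE.
have C0 : 0 <= C by have := le_trans (normr_ge0 _) (fb 0); rewrite pmulr_lge0 ?expR_gt0.
have [] // := @Rdominated R (fun n v => f (en n * v + x) * (2 * (1 + v ^+ 2)^-1))
  (fun v => f x * (2 * (1 + v ^+ 2)^-1)) (fun v => C * 2 * (1 + v ^+ 2)^-1).
- by move=> n; exact: intg_meas (poisson_intg x (en n)).
- by apply: intg_meas; apply: intgZ; exact: intgZ.
- exact: intgZ.
- move=> n v; rewrite normrM -mulrA; apply: ler_pM => //.
    apply: le_trans (fb _) _; rewrite ler_piMr//.
    rewrite expR_le1 oppr_le0; apply: mulr_ge0; [exact: ltW|exact: normr_ge0].
  rewrite ger0_norm//; apply: mulr_ge0 => //.
  by rewrite invr_ge0 ltW// cauchy_gt0.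
move=> v; apply: cvgM; last exact: cvg_cst.
have cc : continuous (fun e : R => f (e * v + x)) by apply: cts_comp => //; cts.
have := cc 0; rewrite /continuous_at mul0r add0r => c0.
by apply: (@cvg_comp _ _ _ en (fun e => f (e * v + x))); [exact: cvg_harmonic|exact: c0].
Qed.

Hypothesis phi0 : forall s, 0 <= phi s.

Lemma abel_pt (s : R) : expR (- (en n * `|s|)) @[n --> \oo] --> (1 : R).
Proof.
have cc : continuous (fun e : R => expR (- (e * `|s|))) by cts.
have := cc 0; rewrite /continuous_at mul0r oppr0 expR0 => c0.
by apply: (@cvg_comp _ _ _ en (fun e => expR (- (e * `|s|)))); [exact: cvg_harmonic|exact: c0].
Qed.

(** At [x = 0] the damped integrands are nonnegative and increase to [phi]. Monotone convergence
    identifies the integral of [phi] with the limit in [abel_lim], which is finite. *)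
Lemma cos_transform_integrable : intg phi.
Proof.
have cphi := cos_transform_cts.
have mphi : measurable_fun setT phi by exact: continuous_measurable_fun.
pose g (n : nat) (s : R) : \bar R := (expR (- (en n * `|s|)) * phi s)%:E.
have gE n : (\int[mu]_s g n s)%E =
    (\int[mu]_s (expR (- (en n * `|s|)) * (phi s * cos (0 * s))))%:E.
  rewrite -Rint_EFin; last exact: abel_intg.
  by apply: eq_integral => s _; rewrite /g mul0r cos0 mulr1.
have L1 : (\int[mu]_s g n s)%E @[n --> \oo] --> (2 * pi * f 0)%:E.
  by rewrite (funext gE); apply: cvg_EFin; [exact: nearW|exact: abel_lim].
have L2 := @cvg_monotone_convergence _ _ _ mu setT measurableT g.
have lg s : limn (g ^~ s) = (phi s)%:E.
  apply/cvg_lim => //; apply: cvg_EFin; first exact: nearW.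
  rewrite -[X in _ --> X]mul1r; apply: cvgM; [exact: abel_pt|exact: cvg_cst].
have E : (\int[mu]_s (phi s)%:E)%E = (2 * pi * f 0)%:E.
  apply: (cvg_unique _ _ L1) => //.
  rewrite (_ : (\int[mu]_s (phi s)%:E)%E = (\int[mu]_s limn (g ^~ s))%E); last first.
    by apply: eq_integral => s _; rewrite lg.
  apply: L2.
  - move=> n; apply/measurable_EFinP; apply: continuous_measurable_fun.
    by cts.
  - by move=> n s _; rewrite lee_fin mulr_ge0 ?expR_ge0.
  - move=> s _ m n mn; rewrite lee_fin ler_wpM2r// ler_expR lerN2 ler_wpM2r//.
    by rewrite lef_pV2 ?posrE ?ltr0n// ler_nat.
apply/integrableP; split; first exact/measurable_EFinP.
rewrite (_ : (\int[mu]_x _)%E = (2 * pi * f 0)%:E) ?ltry// -E.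
by apply: eq_integral => s _ /=; rewrite ger0_norm.
Qed.

(** Now that [phi] is integrable it dominates the damped integrands, so the Abel limit is the
    integral itself. *)
Lemma fourier_inversion x : \int[mu]_s (phi s * cos (x * s)) = 2 * pi * f x.
Proof.
have cphi := cos_transform_cts; have jphi := cos_transform_integrable.
apply: (cvg_unique _ _ (@abel_lim x)) => //.
have [] // := @Rdominated R (fun n s => expR (- (en n * `|s|)) * (phi s * cos (x * s)))
  (fun s => phi s * cos (x * s)) phi.
- by move=> n; apply: continuous_measurable_fun; cts.
- by apply: continuous_measurable_fun; cts.
- move=> n s; rewrite !normrM (ger0_norm (expR_ge0 _)) (ger0_norm (phi0 s)).
  rewrite -[leRHS]mul1r; apply: ler_pM; rewrite ?expR_ge0 ?mulr_ge0//.
    rewrite expR_le1 oppr_le0; apply: mulr_ge0; [exact: ltW|exact: normr_ge0].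
  by rewrite ler_piMr// cos_max.
move=> s; rewrite -[X in _ --> X]mul1r.
by apply: cvgM; [exact: abel_pt|exact: cvg_cst].
Qed.

End Inversion.
End FourierInversion.

(** * The Gamma function on vertical lines *)

Section GammaSquare.
Context {R : realType}.
Notation mu := (@lebesgue_measure R).
Implicit Types (b s v y : R).

Notation Tc s := (@KBlog R (fun u : R => cos (2 * s * u))).

Definition gamma_density b v : R := expR (b * v) * expR (- expR v).
(** [gamc] and [gams] are the real and imaginary parts of Euler's integral at [b + is], in the
    variable [v = ln t]. *)
Definition gamc b s : R := \int[mu]_v (gamma_density b v * cos (s * v)).
Definition gams b s : R := \int[mu]_v (gamma_density b v * sin (s * v)).

Lemma gamma_density_cts b : continuous (gamma_density b).
Proof. by rewrite /gamma_density; cts. Qed.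

Lemma gamma_density_ge0 b v : 0 <= gamma_density b v.
Proof. by rewrite mulr_ge0 ?expR_ge0. Qed.

Lemma gamc_intg b s : 0 < b -> intg (fun v => gamma_density b v * cos (s * v)).
Proof.
move=> b0; apply: intg_le (gam_intg b0); first by have := @gamma_density_cts b => c; cts.
by move=> v; rewrite normrM (ger0_norm (gamma_density_ge0 _ _)) ler_piMr ?gamma_density_ge0 ?cos_max.
Qed.

Lemma gams_intg b s : 0 < b -> intg (fun v => gamma_density b v * sin (s * v)).
Proof.
move=> b0; apply: intg_le (gam_intg b0); first by have := @gamma_density_cts b => c; cts.
by move=> v; rewrite normrM (ger0_norm (gamma_density_ge0 _ _)) ler_piMr ?gamma_density_ge0 ?sin_max.
Qed.

Lemma bnd_expR2 b : 0 < b -> b < 1 ->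
  bnd (fun y : R => y <= 0) (2 * b) (fun y => expR (2 * b * y)) /\
  bnd (fun y : R => 0 <= y) 2 (fun y => expR (2 * b * y)).
Proof.
move=> b0 b1; split; first exact: bnd_expR.
by apply: bnd_leP (bnd_expR _ (2 * b)); lra.
Qed.

(* The autocorrelation of v |-> e^{bv} exp(-e^v), computed with v = y - ln 2 - xi/2. *)
Lemma gamma_density_autocorrelation b (v xi : R) : gamma_density b v * gamma_density b (v + xi) =
  expR (- (2 * b * ln 2)) *
  (expR (2 * b * (v + (ln 2 + xi / 2))) * expR (- (expR (v + (ln 2 + xi / 2)) * cosh (xi / 2)))).
Proof.
have a2 : expR (ln 2) = 2 :> R by rewrite lnK ?posrE.
have -> : expR (v + (ln 2 + xi / 2)) * cosh (xi / 2) = expR v + expR (v + xi).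
  rewrite /cosh mulrA mulrDr -!expRD mulrDl [RHS]addrC; congr (_ + _).
    rewrite (_ : v + _ + _ = (v + xi) + ln 2); last by field.
    by rewrite [expR (_ + ln 2)]expRD a2 mulfK.
  rewrite (_ : v + _ + _ = v + ln 2); last by field.
  by rewrite [expR (_ + ln 2)]expRD a2 mulfK.
by rewrite /gamma_density -!expRD; congr expR; field.
Qed.

(** The sum of squares is a double integral carrying [cos (s * (u - v))]. At fixed [xi = u - v],
    integration over [v] gives the autocorrelation, which is a multiple of [cosh_laplace] of
    [expR (2 * b * y)]; its cosine transform is known. *)
Lemma gamma_square b s : 0 < b -> b < 1 -> gamc b s ^+ 2 + gams b s ^+ 2 =
  expR (- (2 * b * ln 2)) *
  (2 * \int[mu]_y (expR (2 * b * y) * Tc s y)).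
Proof.
move=> b0 b1; have b20 : 0 < 2 * b by rewrite mulr_gt0.
have [H H'] := bnd_expR2 b0 b1.
have ce : continuous (fun y : R => expR (2 * b * y)) by cts.
have ch := @gamma_density_cts b.
have ic := gamc_intg s b0; have js := gams_intg s b0.
rewrite -(cosh_laplace_fourier ce b20 H H').
have [k k0 [C C0 HC]] := kernel_dom b20 H H'.
(* With [y = v + ln 2 + xi / 2] one has [|v| <= |y| + ln 2 + |xi| / 2]. Trading rate [k / 2] in [y]
   for the same rate in [v] costs [k / 4] of the rate [k / 2] in [xi] and the factor
   [expR (k / 2 * ln 2)]. *)
pose A := expR (- (2 * b * ln 2)) * (C * expR (k / 2 * ln 2)).
have A0 : 0 <= A by rewrite !mulr_ge0 ?expR_ge0.
have key (v xi : R) : `|gamma_density b v * gamma_density b (v + xi) * cos (s * xi)| <=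
    A * expR (- (k / 2 * `|v|)) * expR (- (k / 4 * `|xi|)).
  rewrite normrM -[leRHS]mulr1; apply: ler_pM => //; last exact: cos_max.
  rewrite gamma_density_autocorrelation normrM (ger0_norm (expR_ge0 _)).
  have -> : A * expR (- (k / 2 * `|v|)) * expR (- (k / 4 * `|xi|)) =
    expR (- (2 * b * ln 2)) * (C * (expR (k / 2 * ln 2) * expR (- (k / 2 * `|v|)) *
      expR (- (k / 4 * `|xi|)))) by rewrite /A; ring.
  apply: ler_wpM2l; first exact: expR_ge0.
  apply: (le_trans (HC _ _)); rewrite -[leLHS]mulrA; apply: ler_wpM2l => //.
  rewrite -!expRD ler_expR normrM (@ger0_norm _ 2^-1) ?invr_ge0//.
  have : `|v| <= `|v + (ln 2 + xi / 2)| + ln 2 + `|xi| / 2.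
    rewrite -{1}(addrK (ln 2 + xi / 2) v).
    rewrite (le_trans (ler_normB _ _))// -addrA lerD2l.
    rewrite (le_trans (ler_normD _ _))// normrM (@ger0_norm _ 2^-1) ?invr_ge0//.
    by rewrite (@ger0_norm _ (ln 2)) ?ln_ge0 ?ler1n.
  have : 0 <= `|v + (ln 2 + xi / 2)| by [].
  have : 0 <= `|xi| by [].
  set p := `|v + _|; set q := `|v|; set r := `|xi|; set l := ln 2 => r0 p0 h.
  have := ler_wpM2l (ltW k0) h; have := mulr_ge0 (ltW k0) p0; lra.
have iA : intg (fun v => A * expR (- (k / 2 * `|v|))).
  by apply: intgZ; apply: intg_expabs; rewrite divr_gt0.
have ixi : intg (fun xi => expR (- (k / 4 * `|xi|))).
  by apply: intg_expabs; rewrite divr_gt0.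
transitivity (\int[mu]_v \int[mu]_xi (gamma_density b v * gamma_density b (v + xi) * cos (s * xi))).
  transitivity (\int[mu]_v (gamc b s * (gamma_density b v * cos (s * v)) + gams b s * (gamma_density b v * sin (s * v)))).
    by rewrite RintD ?RintZ//; exact: intgZ.
  apply: eq_Rintegral => v _.
  rewrite ![_ * (gamma_density b v * _)]mulrC -!RintZ// -RintD; [|exact: intgZ|exact: intgZ].
  have cF : continuous (fun u => gamma_density b v * gamma_density b u * cos (s * (u - v))) by cts.
  have jF : intg (fun u => gamma_density b v * gamma_density b u * cos (s * (u - v))).
    apply: (@intg_le _ _ (fun u => gamma_density b v * gamma_density b u)) => //; last by apply: intgZ; exact: gam_intg.
    move=> u; rewrite normrM ger0_norm; last by rewrite mulr_ge0 ?gamma_density_ge0.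
    by rewrite ler_piMr ?mulr_ge0 ?gamma_density_ge0// cos_max.
  have [_ I] := Rint_shift v cF jF.
  transitivity (\int[mu]_u (gamma_density b v * gamma_density b u * cos (s * (u - v)))).
    apply: eq_Rintegral => u _.
    have -> : cos (s * (u - v)) = cos (s * u) * cos (s * v) + sin (s * u) * sin (s * v).
      by rewrite mulrBr cosB.
    by ring.
  rewrite -I; apply: eq_Rintegral => u _.
  by rewrite addrK [u + v]addrC.
rewrite (@Rfubini R (fun p => gamma_density b p.1 * gamma_density b (p.1 + p.2) * cos (s * p.2)) _ _ _ iA ixi key).
  have iLT := cosh_laplace_integrable ce b20 H H'.
  have jL : intg (fun xi => cosh_laplace (fun y => expR (2 * b * y)) xi * cos (s * xi)).
    apply: (@intg_le _ _ (fun xi => `|cosh_laplace (fun y => expR (2 * b * y)) xi|)).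
    - by have := cosh_laplace_cts ce b20 H H' => c; cts.
    - by move=> x; rewrite normrM ler_piMr// cos_max.
    - exact: intg_norm.
  rewrite -RintZ//; apply: eq_Rintegral => xi _ /=.
  pose F y := expR (2 * b * y) * expR (- (expR y * cosh (xi / 2))).
  have cF : continuous F by rewrite /F; cts.
  have jF : intg F by exact: cosh_laplace_int ce b20 H H' xi.
  have [jS IS] := Rint_shift (ln 2 + xi / 2) cF jF.
  transitivity (\int[mu]_v (expR (- (2 * b * ln 2)) * cos (s * xi) * F (v + (ln 2 + xi / 2)))).
    by apply: eq_Rintegral => v _; rewrite gamma_density_autocorrelation /F; ring.
  have E2 : cosh_laplace (fun y => expR (2 * b * y)) xi = \int[mu]_x F x.
    reflexivity.
  rewrite (RintZ _ jS) IS E2; move: (\int[mu]_x F x) => I; by ring.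
have mp : measurable_fun setT (fun p : R * R => p.1 + p.2).
  apply: measurable_funD.
    by apply: (@mes_fst R (fun s => s)); cts.
  by apply: (@mes_snd R (fun s => s)); cts.
apply: measurable_funM; last by apply: (@mes_snd R (fun x => cos (s * x))); cts.
apply: measurable_funM; first exact: mes_fst.
exact: (measurableT_comp (continuous_measurable_fun ch) mp).
Qed.

End GammaSquare.

(** * The continued Gamma function and its squared modulus *)

Section Gamma.
Context {R : realType}.
Notation mu := (@lebesgue_measure R).
Notation Tc s := (@KBlog R (fun u : R => cos (2 * s * u))).

Lemma cexpE (x y : R) : cexp (x +i* y) = (expR x * cos y) +i* (expR x * sin y).
Proof. by rewrite /cexp /=; simpc. Qed.

Lemma Gamma_intE (b s : R) : 0 < b -> Gamma_int (b +i* s) = gamc b s +i* gams b s.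
Proof.
move=> b0.
have E (t : R) : 0 < t -> cpow t (b +i* s - 1) * (expR (- t))%:C =
   (gamma_density b (ln t) * cos (s * ln t) / t) +i* (gamma_density b (ln t) * sin (s * ln t) / t).
  move=> t0; rewrite /cpow.
  have -> : (b +i* s - 1) * (ln t)%:C = ((b - 1) * ln t) +i* (s * ln t).
    by apply/eqP; rewrite eq_complex /=; apply/andP; split; apply/eqP; ring.
  have e1 : expR ((b - 1) * ln t) = expR (b * ln t) / t.
    by rewrite mulrBl mul1r expRB lnK.
  rewrite cexpE e1 /gamma_density lnK//; apply/eqP; rewrite eq_complex /=.
  by apply/andP; split; apply/eqP; rewrite ?mulr0 ?subr0 ?add0r; ring.
have ch := @gamma_density_cts R b.
have cc : continuous (fun v => gamma_density b v * cos (s * v)) by cts.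
have cs : continuous (fun v => gamma_density b v * sin (s * v)) by cts.
have [_ Ic] := Rint_ln cc (gamc_intg s b0).
have [_ Is] := Rint_ln cs (gams_intg s b0).
have pos (t : R) : t \in `]0, +oo[%classic -> 0 < t.
  by rewrite inE/= in_itv/= andbT.
rewrite /Gamma_int /cintegral; congr (_ +i* _).
  by rewrite /gamc -Ic; apply: eq_Rintegral => t /pos t0; rewrite E.
by rewrite /gams -Is; apply: eq_Rintegral => t /pos t0; rewrite E.
Qed.

Lemma Gamma_real (p : R) : 0 < p -> Gamma p%:C = (gam p)%:C.
Proof.
move=> p0; rewrite /Gamma /Gamma_shift /= p0 big_ord0 divr1 addr0 Gamma_intE//.
congr (_ +i* _).
  by apply: eq_Rintegral => v _; rewrite mul0r cos0 mulr1.
transitivity (\int[mu]_v (0 * gamma_density p v)).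
  by apply: eq_Rintegral => v _; rewrite mul0r sin0 mulr0 mul0r.
by rewrite RintZ ?mul0r//; exact: gam_intg.
Qed.

Lemma Gamma_shiftE (m : nat) (a s : R) : - m%:R < a -> a < - m%:R + 1 ->
  Gamma_shift (a +i* s) = m.
Proof.
move=> h1 h2; rewrite /Gamma_shift /=; case: m h1 h2 => [|m] h1 h2.
  by rewrite oppr0 in h1; rewrite h1.
have e : m.+1%:R = m%:R + 1 :> R by rewrite natr1.
have a0 : a < 0 by move: h2; rewrite e; have : 0 <= m%:R :> R by []; lra.
rewrite ltNge (ltW a0) /=; congr S; apply: truncn_def.
by apply/andP; split; move: h1 h2; rewrite e; lra.
Qed.

(** The point [a + is] needs [m + 1] shifts and [a + 1 + is] needs [m], so both values contain
    Euler's integral at the same point. The denominators differ by the factor [a + is], nonzero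
    because [a < 0]. *)
Lemma GammaS (m : nat) (a s : R) : - m.+1%:R < a -> a < - m.+1%:R + 1 ->
  Gamma ((a + 1) +i* s) = (a +i* s) * Gamma (a +i* s).
Proof.
move=> h1 h2; have e : m.+1%:R = m%:R + 1 :> R by rewrite natr1.
have m0 : 0 <= m%:R :> R by [].
rewrite /Gamma (Gamma_shiftE s h1 h2) (@Gamma_shiftE m); [|move: h1; rewrite e; lra|move: h2; rewrite e; lra].
rewrite big_ord_recl /= addr0.
have z0 : a +i* s != 0.
  by rewrite eq_complex /= negb_and lt_eqF//; move: h2; rewrite e; lra.
have E1 : (a + 1) +i* s = (a +i* s) + 1.
  by apply/eqP; rewrite eq_complex /= addr0 !eqxx.
have -> : (a + 1) +i* s + m%:R = (a +i* s) + m.+1%:R by rewrite E1 -addrA mulrS.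
have -> : \prod_(i < m) ((a +i* s) + (bump 0 i)%:R) = \prod_(k < m) ((a + 1) +i* s + k%:R).
  by apply: eq_bigr => i _; rewrite E1 -addrA /bump /= add1n mulrS.
by rewrite invfM mulrCA mulVKf.
Qed.

Lemma Gamma_normsq (m : nat) : forall (nu s : R), 2 * m%:R - 2 < nu < 2 * m%:R ->
  `|Gamma (- (nu / 2) +i* s)| ^+ 2 =
  (expR (nu * ln 2) * (2 * \int[mu]_y (remK nu m y * Tc s y)))%:C.
Proof.
elim: m => [|m IH] nu s /andP[n1 n2].
  have a0 : 0 < - (nu / 2) by lra.
  have a1 : - (nu / 2) < 1 by lra.
  rewrite /Gamma (@Gamma_shiftE 0 (- (nu / 2))) ?oppr0 ?add0r// big_ord0 divr1 addr0.
  rewrite Gamma_intE// -add_Re2_Im2 /= gamma_square//.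
  have -> : - (2 * - (nu / 2) * ln 2) = nu * ln 2 by field.
  congr (_ * (_ * _))%:C; apply: eq_Rintegral => y _.
  rewrite /remK big_geq// mulr0 subr0; congr (expR _ * _); by field.
have e : m.+1%:R = m%:R + 1 :> R by rewrite natr1.
have m0 : 0 <= m%:R :> R by [].
have nu0 : 0 < nu by move: n1; rewrite e; lra.
have hn : 2 * m%:R - 2 < nu - 2 < 2 * m%:R.
  by apply/andP; split; move: n1 n2; rewrite e; lra.
have g1 : - m.+1%:R < - (nu / 2) by move: n2; rewrite e; lra.
have g2 : - (nu / 2) < - m.+1%:R + 1 by move: n1; rewrite e; lra.
pose I0 := \int[mu]_y (remK (nu - 2) m y * Tc s y).
pose I1 := \int[mu]_y (remK nu m.+1 y * Tc s y).
have IHs : `|Gamma (- ((nu - 2) / 2) +i* s)| ^+ 2 =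
  (expR ((nu - 2) * ln 2) * (2 * I0))%:C := IH (nu - 2) s hn.
have hn1 : 2 * m.+1%:R - 2 < nu < 2 * m.+1%:R by rewrite n1 n2.
have T1 := remK_tame hn1.
have [d d0 [H1 _ H3 _]] := remK_tame hn.
have S : (nu ^+ 2 + 4 * s ^+ 2) * I1 = I0.
  exact: (@mellin_step R (remK nu m.+1) (dremK nu m.+1) (remK (nu - 2) m) nu d s d0
    (remK_derive nu m.+1) (fun y => @dremK_derive R nu m.+1 y isT n1)
    (dv_cts (remK_derive (nu - 2) m)) T1 H1 H3).
have GS : Gamma (- ((nu - 2) / 2) +i* s) = (- (nu / 2) +i* s) * Gamma (- (nu / 2) +i* s).
  have -> : - ((nu - 2) / 2) = - (nu / 2) + 1 by field.
  exact: (GammaS s g1 g2).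
have q0 : 0 < nu ^+ 2 + 4 * s ^+ 2 by rewrite ltr_pwDl ?exprn_gt0// mulr_ge0// sqr_ge0.
have zn : `|- (nu / 2) +i* s| ^+ 2 = ((nu ^+ 2 + 4 * s ^+ 2) / 4)%:C.
  by rewrite -add_Re2_Im2 /=; congr (_%:C); field.
have z0 : ((nu ^+ 2 + 4 * s ^+ 2) / 4)%:C != 0 :> R[i].
  by rewrite eq_complex /= negb_and gt_eqF// divr_gt0.
(* After multiplication by [|a + is|^2 = (nu^2 + 4 s^2) / 4], [GammaS] leads to the induction
   hypothesis on the left. On the right [mellin_step] accounts for [nu^2 + 4 s^2], and 1/4 is the
   ratio of [2^{nu-2}] to [2^nu]. *)
rewrite -/I1; apply: (mulfI z0).
rewrite -[X in X * _]zn -exprMn -normrM -GS IHs -S -rmorphM; congr (_%:C).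
have -> : (nu - 2) * ln 2 = nu * ln 2 - 2%:R * ln 2 by ring.
rewrite expRB expRM_natl lnK ?posrE//.
by field.
Qed.

Lemma ccosh_real (x : R) : ccosh x%:C = (cosh x)%:C.
Proof.
rewrite /ccosh /cexp /= oppr0 cos0 sin0.
have -> : (1 +i* 0) = 1 :> R[i] by [].
by rewrite !mulr1 -rmorphD -(rmorph_nat (real_complex R)) -fmorphV -rmorphM.
Qed.

Lemma BesselK_real (w x : R) : 0 < x ->
  BesselK w%:C x = (2^-1 * KB (fun u => cosh (w * u)) x)%:C.
Proof.
move=> x0; have E (u : R) : (expR (- x * cosh u))%:C * ccosh (w%:C * u%:C) =
   (expR (- (x * cosh u)) * cosh (w * u))%:C.
  by rewrite -rmorphM ccosh_real -rmorphM mulNr.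
rewrite /BesselK /cintegral; congr (_ +i* _).
  have ck : continuous (fun u => expR (- (x * cosh u)) * cosh (w * u)) by cts.
  have jk := KB_intg x0 (expbnd_coshw w).
  have [|_ I] := Rint_even ck jk; first by move=> u; rewrite coshN mulrN coshN.
  rewrite /KB -I; apply: eq_Rintegral => u _; by rewrite E.
transitivity (\int[mu]_(u in `]0%R, +oo[) (0 : R)).
  by apply: eq_Rintegral => u _; rewrite E.
by rewrite /Rintegral integral0.
Qed.

End Gamma.

(** * Fourier transform of the squared modulus *)

Theorem proposition4p1 (R : realType) (n : nat) (a : R)
    (ha : - n%:R - 1 < a < - n%:R) (xi : R) :
  let lhs (s : R) : R[i] :=
    cexp (- (0 +i* (xi * s))) * `| Gamma (a +i* s) | ^+ 2 in
  let rhs (x : R) : R[i] :=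
    (x `^ (2 * a - 1))%:C
    * (1 + ((2 / x) `^ (2 * a))%:C
           * \sum_(0 <= k < n.+1)
               (4 * (a + k%:R))%:C
               / ((k`!)%:R * Gamma (1 - k%:R - 2 * a)%:C)
               * BesselK (2 * a + 2 * k%:R)%:C x)
    * (expR (- x * cosh (xi / 2)))%:C in
  [/\ cintegrable setT lhs,
      cintegrable `]0, +oo[ rhs
    & cintegral setT lhs
      = (2 * pi / 2 `^ (2 * a))%:C * cintegral `]0, +oo[ rhs].
Proof.
move=> lhs rhs.
pose mu := @lebesgue_measure R.
pose nu := - (2 * a).
have e1 : n.+1%:R = n%:R + 1 :> R by rewrite natr1.
have n0 : 0 <= n%:R :> R by [].
have hnu : 2 * n.+1%:R - 2 < nu < 2 * n.+1%:R.
  by move/andP: ha => [h1 h2]; apply/andP; split; rewrite e1 /nu; lra.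
have [nu1 nu2] := andP hnu.
pose D := remK nu n.+1.
have [d d0 [H1 _ H3 _]] := remK_tame hnu.
have cD : continuous D := dv_cts (remK_derive nu n.+1).
pose Tc (s : R) := @KBlog R (fun u : R => cos (2 * s * u)).
pose f := cosh_laplace D.
have [k k0 [C C0 fb]] := cosh_laplace_bound cD d0 H1 H3.
have cf : continuous f := cosh_laplace_cts cD d0 H1 H3.
have ef (x : R) : f (- x) = f x by exact: cosh_laplace_even.
pose phi (s : R) := \int[mu]_x (f x * cos (s * x)).
pose c := expR (nu * ln 2).
have c0 : 0 < c by exact: expR_gt0.
have G s : `|Gamma (a +i* s)| ^+ 2 = (c * phi s)%:C.
  have -> : a = - (nu / 2) by rewrite /nu; field.
  by rewrite (Gamma_normsq s hnu) /phi (cosh_laplace_fourier cD d0 H1 H3).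
(* The sign needed for the inversion is not visible on the cosine transform; it comes from the
   squared modulus. *)
have phi0 s : 0 <= phi s.
  have : 0 <= `|Gamma (a +i* s)| ^+ 2 by rewrite exprn_ge0.
  by rewrite G ler0c pmulr_rge0.
have jphi : intg phi := cos_transform_integrable cf k0 fb ef phi0.
have cphi : continuous phi := cos_transform_cts cf k0 fb.
have Inv : \int[mu]_s (phi s * cos (xi * s)) = 2 * pi * f xi :=
  fourier_inversion cf k0 fb ef phi0 xi.
have lhsE s : lhs s = (c * (phi s * cos (xi * s))) +i* (- (c * (phi s * sin (xi * s)))).
  rewrite /lhs G.
  have -> : - (0 +i* (xi * s)) = (0 : R) +i* (- (xi * s)).
    by apply/eqP; rewrite eq_complex /= oppr0 !eqxx.
  rewrite cexpE expR0 cosN sinN; apply/eqP; rewrite eq_complex /=.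
  by apply/andP; split; apply/eqP; ring.
have jc : intg (fun s => phi s * cos (xi * s)).
  apply: intg_le jphi; first by cts.
  by move=> s; rewrite normrM ger0_norm// ler_piMr// cos_max.
have cs : continuous (fun s => phi s * sin (xi * s)) by cts.
have js : intg (fun s => phi s * sin (xi * s)).
  apply: intg_le jphi => //.
  by move=> s; rewrite normrM ger0_norm// ler_piMr// sin_max.
(* Evenness makes the imaginary part of the left-hand side vanish. *)
have phiN s : phi (- s) = phi s.
  by apply: eq_Rintegral => x _; rewrite mulNr cosN.
have Is : \int[mu]_s (phi s * sin (xi * s)) = 0.
  have [_] := Rint_opp cs js.
  have -> : \int[mu]_s (phi (- s) * sin (xi * - s)) = - \int[mu]_s (phi s * sin (xi * s)).
    rewrite -mulN1r -RintZ//; apply: eq_Rintegral => s _.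
    by rewrite phiN mulrN sinN; ring.
  by move=> h; lra.
pose h (y : R) := D y * expR (- (expR y * cosh (xi / 2))).
have ch : continuous h by rewrite /h; cts.
have jh : intg h := cosh_laplace_int cD d0 H1 H3 xi.
have [jr Ir] := Rint_ln ch jh.
have cM (x y : R) : x%:C * y%:C = (x * y)%:C by rewrite rmorphM.
have cV (x : R) : (x%:C)^-1 = (x^-1)%:C by rewrite fmorphV.
(* The exponent [2 a - 1], one less than in [D_nu], supplies the Jacobian [1 / x] of [y = ln x]. *)
have rhsE (x : R) : 0 < x -> rhs x = (h (ln x) / x)%:C.
  move=> x0; rewrite /rhs.
  have p (r : R) : x `^ r = expR (r * ln x) by rewrite /powR gt_eqF.
  have p2 : (2 / x) `^ (2 * a) = expR (- (nu * ln 2)) * expR (nu * ln x).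
    rewrite /powR gt_eqF ?divr_gt0// ln_div ?posrE// -expRD; congr expR.
    by rewrite /nu; ring.
  have p1 : x `^ (2 * a - 1) = expR (- nu * ln x) / x.
    rewrite p.
    have -> : (2 * a - 1) * ln x = - nu * ln x - ln x by rewrite /nu; ring.
    by rewrite expRB lnK ?posrE.
  have -> : \sum_(0 <= k < n.+1) (4 * (a + k%:R))%:C
               / ((k`!)%:R * Gamma (1 - k%:R - 2 * a)%:C)
               * BesselK (2 * a + 2 * k%:R)%:C x =
     (- \sum_(0 <= k < n.+1) bcoef nu k * KBlog (fun u => cosh ((nu - 2 * k%:R) * u)) (ln x))%:C.
    rewrite rmorphN rmorph_sum -sumrN; apply: eq_big_nat => j /andP[_ jn].
    have jn' : j%:R <= n%:R :> R by rewrite ler_nat.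
    (* Since [j <= n] and [nu > 2 n], the argument of [Gamma] is positive, and [Gamma] is Euler's
       integral there. *)
    have p0 : 0 < 1 + nu - j%:R by move: nu1; rewrite e1; lra.
    have -> : 1 - j%:R - 2 * a = 1 + nu - j%:R by rewrite /nu; ring.
    rewrite Gamma_real// BesselK_real// -(rmorph_nat (real_complex R)) cM cV !cM -rmorphN.
    congr (_%:C); rewrite /KBlog lnK ?posrE//.
    (* The order [2 a + 2 j] is [- (nu - 2 j)], and the Macdonald function is even in its order. *)
    have -> : (fun u => cosh ((2 * a + 2 * j%:R) * u)) = (fun u => cosh ((nu - 2 * j%:R) * u)).
      by apply/funext => u; rewrite -coshN; congr cosh; rewrite /nu; ring.
    set K := KB _ x; have g0 := gam_gt0 p0.
    have f0 : 0 < j`!%:R :> R by rewrite ltr0n fact_gt0.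
    have -> : a = - (nu / 2) by rewrite /nu; field.
    rewrite /bcoef; set g := gam _ in g0 *; set F := j`!%:R in f0 *.
    by field; rewrite !gt_eqF.
  rewrite p1 p2 cM -(rmorph1 (real_complex R)) -rmorphD !cM.
  congr (_%:C); rewrite /h /D /remK lnK ?posrE// [- x * cosh _]mulNr.
  set S := \sum_(0 <= k < n.+1) _; set E := expR (- (x * _)).
  have ee : expR (- nu * ln x) * expR (nu * ln x) = 1.
    by rewrite -expRD mulNr addNr expR0.
  transitivity ((expR (- nu * ln x) -
    (expR (- nu * ln x) * expR (nu * ln x)) * expR (- (nu * ln 2)) * S) * E / x).
    by ring.
  by rewrite ee mul1r.
split.
- split.
    apply: (@eq_integrable _ _ _ mu setT measurableT (fun s => (c * (phi s * cos (xi * s)))%:E)).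
      by move=> s _; rewrite lhsE.
    exact: (intgZ c jc).
  apply: (@eq_integrable _ _ _ mu setT measurableT (fun s => (- (c * (phi s * sin (xi * s))))%:E)).
    by move=> s _; rewrite lhsE.
  exact: (intgN (intgZ c js)).
- split.
    apply: (@eq_integrable _ _ _ mu _ _ (fun x => (h (ln x) / x)%:E)) => //.
    by move=> x; rewrite inE/= in_itv/= andbT => x0; rewrite rhsE.
  apply: (@eq_integrable _ _ _ mu _ _ (cst 0%E)) => //; last exact: integrable0.
  by move=> x; rewrite inE/= in_itv/= andbT => x0; rewrite rhsE.
have L : cintegral setT lhs = (c * (2 * pi * f xi))%:C.
  rewrite /cintegral; congr (_ +i* _).
    rewrite -Inv -RintZ//; apply: eq_Rintegral => s _; by rewrite lhsE.
  transitivity (\int[mu]_s (- c * (phi s * sin (xi * s)))).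
    by apply: eq_Rintegral => s _; rewrite lhsE /= mulNr.
  by rewrite RintZ// Is mulr0.
have Rr : cintegral `]0, +oo[ rhs = (f xi)%:C.
  rewrite /cintegral; congr (_ +i* _).
    rewrite -[RHS]Ir; apply: eq_Rintegral => x; rewrite inE/= in_itv/= andbT => x0.
    by rewrite rhsE.
  transitivity (\int[mu]_(x in `]0%R, +oo[) (0 : R)).
    apply: eq_Rintegral => x; rewrite inE/= in_itv/= andbT => x0.
    by rewrite rhsE.
  by rewrite /Rintegral integral0.
rewrite L Rr -rmorphM; congr (_%:C).
have -> : 2 `^ (2 * a) = c^-1.
  rewrite /powR gt_eqF// /c -expRN; congr expR; rewrite /nu; ring.
rewrite invrK; ring.
Qed.
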